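(* Let $T$ be a very small minimal $\mathbb{R}$-tree with isometric $F_N$-action ($N\ge2$) that has dense orbits, and let $\mathcal{A}$ be a basis of $F_N$. Then there exists a sequence of finite subtrees $K(n)\subset T$ ($n\in\mathbb{N}$) of uniformly bounded diameter, with $K(n)\cap aK(n)\neq\emptyset$ for all $a\in\mathcal{A}$, such that $$T=\lim_{n\to\infty}T_{\mathcal{K}(n)},$$ where $\mathcal{K}(n)=(K(n),\mathcal{A})$ is the system of partial isometries induced on $K(n)$.
   Context: For actions with dense orbits, ''very small'' is equivalent to trivial arc stabilizers. A finite subtree is the convex hull of finitely many points. For a compact subtree $K\subset\overline{T}$ (metric completion of $T$) with $K\cap aK\ne\emptyset$ for all $a\in\mathcal{A}$, the induced system $\mathcal{K}=(K,\mathcal{A})$ consists of the partial isometries $a:K\cap aK\to K\cap a^{-1}K$, $x\mapsto xa:=a^{-1}x$; a reduced word $w=z_1\cdots z_n$ in $\mathcal{A}^{\pm1}$ acts on the right as the composition $x\mapsto xw=(\cdots(xz_1)\cdots)z_n$. The $\mathbb{R}$-tree $T_{\mathcal{K}}$ is $F_N\times K/\sim$, where $(u,x)\sim(v,y)$ iff $x(u^{-1}v)=y$, with the quotient path metric obtained by gluing the copies $\{u\}\times K$ of $K$ (each embeds isometrically) and the isometric left action $w[(u,x)]=[(wu,x)]$. The limit is understood in the closure $\overline{\mathrm{cv}}_N$ of unprojectivized Outer space, whose points are (equivariant isometry classes of) minimal very small $\mathbb{R}$-trees with $F_N$-action; $T_{\mathcal{K}(n)}$ is represented there by its minimal $F_N$-invariant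 subtree. Equivalently, $\|w\|_{T_{\mathcal{K}(n)}}\to\|w\|_T$ for every $w\in F_N$, where $\|w\|_S=\inf_{x\in S}d(x,wx)$ is the translation length. *)

(* Defs.v *)
From HB Require Import structures.
From mathcomp Require Import all_boot all_order all_algebra.
From mathcomp Require Import all_classical reals topology normedtype.

Set Implicit Arguments.
Unset Strict Implicit.
Unset Printing Implicit Defensive.

Import Order.TTheory GRing.Theory Num.Theory.
Import numFieldNormedType.Exports.

Local Open Scope classical_set_scope.
Local Open Scope ring_scope.
Local Open Scope quotient_scope.

(** * R-trees *)

Section Trees.
Context {R : realType} {T : metricType R}.
Implicit Types (x y z : T) (S K : set T).

Definition geodesic_space : Prop :=
  forall x y, exists gamma : R -> T,
    [/\ gamma 0 = x, gamma (mdist x y) = y &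
        forall s t, 0 <= s <= mdist x y -> 0 <= t <= mdist x y ->
          mdist (gamma s) (gamma t) = `|s - t|].

(* Gromov's four-point condition with constant 0 *)
Definition zero_hyperbolic : Prop :=
  forall x y z t : T,
    mdist x y + mdist z t
      <= Num.max (mdist x z + mdist y t) (mdist x t + mdist y z).

Definition real_tree : Prop :=
  [/\ [set: T] !=set0, geodesic_space & zero_hyperbolic].

(* In an R-tree these are exactly the points of the unique arc from x to y. *)
Definition segment x y : set T :=
  [set z | mdist x z + mdist z y = mdist x y].

Definition geod_convex S : Prop :=
  forall x y, S x -> S y -> segment x y `<=` S.

Definition subtree S : Prop := S !=set0 /\ geod_convex S.

Definition convex_hull S : set T := smallest geod_convex S.

Definition finite_subtree K : Prop :=
  exists A : set T, [/\ finite_set A, A !=set0 & K = convex_hull A].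

End Trees.
Arguments real_tree {R} T.

Definition translation_length {R : realType} {X : Type}
  (d : X -> X -> R) (f : X -> X) : R := inf [set d x (f x) | x in [set: X]].

(** * Isometric actions *)

Record isom_action {R : realType} (G : groupType) (T : metricType R) := {
  act :> G -> T -> T ;
  act1 : forall x, act 1%g x = x ;
  actM : forall g h x, act (g * h)%g x = act g (act h x) ;
  act_isom : forall g x y, mdist (act g x) (act g y) = mdist x y }.

Definition cyclic_subgroup {G : groupType} (c : G) : set G :=
  [set g | exists k : nat, g = (c ^+ k)%g \/ g = (c ^- k)%g].

Definition maximal_cyclic {G : groupType} (H : set G) : Prop :=
  (exists c, H = cyclic_subgroup c) /\
  forall c, H `<=` cyclic_subgroup c -> H = cyclic_subgroup c.

Section Actions.
Context {R : realType} {G : groupType} {T : metricType R}.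
Variable rho : isom_action G T.

Definition pointwise_stab (S : set T) : set G :=
  [set g | forall x, S x -> rho g x = x].

Definition minimal_action : Prop :=
  forall S : set T, subtree S -> (forall g x, S x -> S (rho g x)) ->
    S = [set: T].

Definition dense_orbits : Prop :=
  forall x : T, dense (range (rho ^~ x)).

(* Cohen-Lustig: stabilizers of nondegenerate arcs are trivial or maximal
   cyclic, and stabilizers of tripods are trivial. *)
Definition very_small : Prop :=
  (forall x y : T, x <> y ->
     pointwise_stab (segment x y) = [set 1%g] \/
     maximal_cyclic (pointwise_stab (segment x y))) /\
  (forall x y z : T,
     ~ segment y z x -> ~ segment x z y -> ~ segment x y z ->
     pointwise_stab (convex_hull [set x; y; z]) = [set 1%g]).

End Actions.

(** * Free groups *)

(* (i, false) is the i-th generator and (i, true) is its inverse. *)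
Definition letter (N : nat) : Type := ('I_N * bool)%type.

Definition letter_inv {N} (z : letter N) : letter N := (z.1, ~~ z.2).

Definition reduced {N} (w : seq (letter N)) : bool :=
  sorted (fun z z' : letter N => z' != letter_inv z) w.

Section Words.
Context {N : nat} {G : groupType}.
Variable a : 'I_N -> G.

Definition letter_val (z : letter N) : G :=
  if z.2 then ((a z.1)^-1)%g else a z.1.

Definition word_val (w : seq (letter N)) : G :=
  (\prod_(z <- w) letter_val z)%g.

Definition free_basis : Prop :=
  forall g : G, exists! w : seq (letter N), reduced w /\ word_val w = g.

End Words.

(** * The system of partial isometries induced on K, and the tree T_K *)

Section System.
Context {R : realType} {N : nat} {G : groupType} {T : metricType R}.
Variables (rho : isom_action G T) (a : 'I_N -> G) (K : set T).

Definition translate (g : G) : set T := [set rho g x | x in K].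

(* Graph of z : K `&` z K -> K `&` z^-1 K, x |-> z^-1 x.  For z the inverse
   of a generator this is the inverse of the partial isometry of that
   generator. *)
Definition letter_rel (z : letter N) (x y : T) : Prop :=
  (K `&` translate (letter_val a z)) x /\ y = rho ((letter_val a z)^-1)%g x.

(* Graph of x |-> x w: the letters are applied from left to right. *)
Fixpoint word_rel (w : seq (letter N)) (x y : T) : Prop :=
  if w is z :: w' then exists2 x', letter_rel z x x' & word_rel w' x' y
  else K x /\ y = x.

Definition glued (p q : G * K) : Prop :=
  exists w, [/\ reduced w, word_val a w = (p.1^-1 * q.1)%g &
                word_rel w (val p.2) (val q.2)].

Lemma letter_valV z : letter_val a (letter_inv z) = ((letter_val a z)^-1)%g.
Proof. by case: z => i [] //=; rewrite /letter_val /= invgK. Qed.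

Lemma letter_invK : involutive (@letter_inv N).
Proof. by case=> i b; rewrite /letter_inv /= negbK. Qed.

Lemma letter_relV z x y : letter_rel z x y -> letter_rel (letter_inv z) y x.
Proof.
rewrite /letter_rel letter_valV invgK => -[[Kx [t Kt tx]] ->].
rewrite -actM mulgV act1; split=> //; split; last by exists x.
by rewrite -tx -actM mulVg act1.
Qed.

Lemma letter_rel_fun z x y y' : letter_rel z x y -> letter_rel z x y' -> y = y'.
Proof. by move=> [_ ->] [_ ->]. Qed.

Lemma word_rel_cat w w' x y z :
  word_rel w x y -> word_rel w' y z -> word_rel (w ++ w') x z.
Proof.
elim: w x => [|l w IH] x /=; first by move=> [_ ->].
by move=> [x' lx wx] wy; exists x' => //; exact: IH.
Qed.

Lemma word_rel_inv w x y :
  word_rel w x y -> word_rel (rev (map letter_inv w)) y x.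
Proof.
elim: w x => [|l w IH] x /=; first by move=> [Kx ->].
move=> [x' lx /IH wy]; rewrite rev_cons -cats1.
apply: word_rel_cat wy _ => /=; exists x; first exact: letter_relV.
by case: lx => -[].
Qed.

Lemma word_val_inv w :
  word_val a (rev (map letter_inv w)) = ((word_val a w)^-1)%g.
Proof.
rewrite /word_val; elim: w => [|l w IH]; first by rewrite !big_nil invg1.
rewrite /= rev_cons -cats1 big_cat /= IH big_seq1 big_cons letter_valV.
by rewrite invgM.
Qed.

Lemma word_rel_reduce w x y : word_rel w x y ->
  exists w', [/\ reduced w', word_val a w' = word_val a w & word_rel w' x y].
Proof.
elim: w x => [|l w IH] x /=; first by exists [::].
move=> [x' lx /IH [w' [rw' vw' ww']]]; rewrite /word_val big_cons.
case: w' rw' vw' ww' => [|l' w'] rw' vw' ww'.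
  exists [:: l]; split=> //=; last by exists x'.
  by rewrite big_seq1 -[bigop _ _ _]vw' /word_val big_nil mulg1.
have [ll'|ll'] := eqVneq l' (letter_inv l); last first.
  exists [:: l, l' & w']; split => /=; first by rewrite ll'.
    by rewrite big_cons -[bigop _ w _]vw'.
  by exists x'.
exists w'; split; first exact: path_sorted rw'.
  rewrite -[bigop _ w _]vw' /word_val big_cons ll' letter_valV.
  by rewrite mulgA mulgV mul1g.
case: ww' => x'' l'x' w'x''; rewrite ll' in l'x'.
by rewrite (letter_rel_fun (letter_relV lx) l'x').
Qed.

Lemma glued_refl p : glued p p.
Proof.
exists [::]; split=> //; first by rewrite /word_val big_nil mulVg.
by split=> //; exact: set_valP.
Qed.

Lemma glued_sym p q : glued p q -> glued q p.
Proof.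
move=> [w [_ vw /word_rel_inv/word_rel_reduce [w' [rw' vw' ww']]]].
by exists w'; split=> //; rewrite vw' word_val_inv vw invgM invgK.
Qed.

Lemma glued_trans p q r : glued p q -> glued q r -> glued p r.
Proof.
move=> [w [_ vw pq]] [w' [_ vw' qr]].
have [w2 [rw2 vw2 pr]] := word_rel_reduce (word_rel_cat pq qr).
exists w2; split=> //; rewrite vw2 /word_val big_cat /= -![bigop _ _ _]/(word_val a _).
by rewrite vw vw' mulgA -(mulgA _ q.1) mulgV mulg1.
Qed.

Definition gluedb (p q : G * K) : bool := `[< glued p q >].

Lemma gluedb_refl : reflexive gluedb.
Proof. by move=> p; apply/asboolP; exact: glued_refl. Qed.

Lemma gluedb_sym : symmetric gluedb.
Proof. by move=> p q; apply/asboolP/asboolP; exact: glued_sym. Qed.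

Lemma gluedb_trans : transitive gluedb.
Proof.
by move=> q p r /asboolP pq /asboolP qr; apply/asboolP; exact: glued_trans qr.
Qed.

Canonical gluedb_equiv := EquivRel gluedb gluedb_refl gluedb_sym gluedb_trans.

Definition system_tree : Type := {eq_quot gluedb_equiv}.

Definition system_class (u : G) (x : K) : system_tree :=
  \pi_{eq_quot gluedb_equiv} (u, x).

Lemma system_classP u x v y :
  system_class u x = system_class v y <-> glued (u, x) (v, y).
Proof.
rewrite /system_class; split.
  by move=> /eqquotP /asboolP.
by move=> uv; apply/eqquotP/asboolP.
Qed.

Definition system_act (w : G) (X : system_tree) : system_tree :=
  let p := repr (X : {eq_quot gluedb_equiv}) in system_class (w * p.1)%g p.2.

Lemma system_actE w u x :
  system_act w (system_class u x) = system_class (w * u)%g x.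
Proof.
rewrite /system_act; case E: (repr _) => [v y] /=.
have : glued (v, y) (u, x).
  by apply/system_classP; rewrite {1}/system_class -E reprK.
move=> [l [rl vl yx]]; apply/system_classP; exists l; split=> //=.
by rewrite vl /= invgM -!mulgA mulKg.
Qed.

(* A chain from X to Y: each entry (u, (x, y)) is a path from (u, x) to (u, y)
   inside the copy {u} x K, consecutive entries being joined by gluing. *)
Fixpoint chain (X : system_tree) (c : seq (G * (K * K))) (Y : system_tree) :
    Prop :=
  if c is (u, (x, y)) :: c' then
    X = system_class u x /\ chain (system_class u y) c' Y
  else X = Y.

Definition chain_length (c : seq (G * (K * K))) : R :=
  \sum_(e <- c) mdist (val e.2.1) (val e.2.2).

(* The infimum is over a nonempty set as soon as K meets each of its
   translates by the generators (and they generate G). *)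
Definition system_dist (X Y : system_tree) : R :=
  inf [set chain_length c | c in [set c | chain X c Y]].

End System.

(* Main.v *)
Require Import Defs.
From mathcomp Require Import all_boot all_order all_algebra.
From mathcomp Require Import all_classical reals topology normedtype.
From mathcomp Require Import ereal measure numfun measurable_realfun.
From mathcomp Require Import lebesgue_measure lebesgue_integral.
From mathcomp Require Import lra zify.
Import Order.TTheory GRing.Theory Num.Theory.
Import numFieldNormedType.Exports.
Local Open Scope classical_set_scope.
Local Open Scope ring_scope.
Set Implicit Arguments.
Unset Strict Implicit.


(** Fix a base point [o] of the tree [T], and send the Cayley tree of the free
    group to [T] by [g |-> g o], geodesically on edges.  The whole proof rests
    on bounded backtracking: along a reduced word, the images of the vertices
    stay within a uniform distance of the arc between the images of the ends
    ([bounded_backtracking]).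

    Given this, let [K] be a large ball about [o].  By density of the orbits
    every translation length of [T] is almost realized, after a conjugation, at
    a point [y] close to [o], by some reduced word [w] moving [y] to [w y].
    Push the vertices of the path [w] to the arc from [y] to [w y] and take
    running maxima of their positions: since backtracking is bounded, the
    position reached at the [i]-th prefix [u_i] of [w] lies in [u_i K] and also
    in [u_(i+1) K].  So the arc is cut into successive pieces that lie in
    successive copies of [K], and lifts to the tree of the system on [K]
    without gaining length ([short_chain]).  Finitely many points of [K] are
    involved for each word and each precision.  The group being countable, the
    convex hulls [K n] of the first finitely many of these finite sets are
    finite subtrees of one ball for which the translation lengths converge from
    above; they are bounded from below by those of [T], because the tree of the
    system maps to [T] equivariantly without increasing lengths ([develop_le]).

    Bounded backtracking is proved by a counting version of the folding
    argument.  Suppose that two reduced words [w], [w'] with distinct first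
    letters both lead across the same arc of length [C] starting at [o].  To
    each point [s] of (0, C) correspond an edge of the path [w] and an edge of
    [w'] passing over it, hence two points of the rose, whose total length [V]
    is that of the generators; draw an edge labelled [s] between them.  This is
    the identification that folding performs at time [s].  If arc stabilizers
    were trivial, it would join two points not yet identified modulo the group,
    so that the graph would be a forest.  With cyclic arc stabilizers a second
    kind of identification occurs, of a point with a translate of itself, but
    only once for each point, because the relation of being identified before
    time [s] is closed under roots ([linked_root]).  So finite subgraphs have
    at most twice as many edges as vertices ([folding_bound]).  The
    correspondence between labels and ends is piecewise a translation or a
    reflection of the line, with finitely many constants, and these generate a
    group of polynomial growth: large boxes of this group give finite subgraphs
    with few boundary edges, and averaging turns the inequality between numbers
    into [C <= 4 * V] ([interval_graph_bound]). *)

(** * Geometry of R-trees and of their isometries *)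

Section TreeGeometry.
Context {R : realType} {T : metricType R}.
Hypothesis hT : real_tree T.
Implicit Types p q r x y z : T.

Lemma four_point x y z t : mdist x y + mdist z t <= mdist x z + mdist y t \/
  mdist x y + mdist z t <= mdist x t + mdist y z.
Proof. by case: hT => _ _ /(_ x y z t); rewrite le_max => /orP. Qed.

Lemma segment_sym x y z : segment x y z -> segment y x z.
Proof.
rewrite /segment /= => h.
by rewrite (metric_sym y z) (metric_sym z x) (metric_sym y x) addrC.
Qed.

Lemma segmentl x y : segment x y x.
Proof. by rewrite /segment /= mdistxx add0r. Qed.

Lemma segmentr x y : segment x y y.
Proof. by rewrite /segment /= mdistxx addr0. Qed.

(** The form in which the four-point condition is used: triangles are tripods. *)
Lemma segment_split p q r y : segment p q y -> segment p r y \/ segment r q y.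
Proof.
rewrite /segment /= => h.
have t1 := metric_triangle p y r; have t2 := metric_triangle r y q.
rewrite (metric_sym r y) in t2.
rewrite (metric_sym r y).
by have [h4|h4] := four_point p q y r;
  rewrite ?(metric_sym q r) ?(metric_sym q y) in h4; [right|left]; lra.
Qed.

Lemma segment_dist x y p q : segment x y p -> segment x y q ->
  mdist p q = `|mdist x p - mdist x q|.
Proof.
rewrite /segment /= => hp hq.
have t1 := metric_triangle x p q; have t2 := metric_triangle x q p.
rewrite (metric_sym q p) in t2.
have := four_point x y p q.
rewrite (metric_sym y p) (metric_sym y q) => h.
have [le|le] := ler0P (mdist x p - mdist x q); case: h => h; lra.
Qed.

Lemma segment_inj x y p q : segment x y p -> segment x y q ->
  mdist x p = mdist x q -> p = q.
Proof.
move=> hp hq e; apply: mdist_positivity.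
by rewrite (segment_dist hp hq) e subrr normr0.
Qed.

Lemma segment_trans x y p q : segment x y q -> segment x q p -> segment x y p.
Proof.
rewrite /segment /= => hq hp.
have t1 := metric_triangle x p y; have t2 := metric_triangle p q y; lra.
Qed.

Lemma geodesic_exists x y : exists gamma : R -> T,
  [/\ gamma 0 = x, gamma (mdist x y) = y &
      forall s t, 0 <= s <= mdist x y -> 0 <= t <= mdist x y ->
        mdist (gamma s) (gamma t) = `|s - t|].
Proof. by case: hT => _ /(_ x y). Qed.

Definition geo x y : R -> T := projT1 (cid (geodesic_exists x y)).

Lemma geo0 x y : geo x y 0 = x.
Proof. by rewrite /geo; case: cid => g /= []. Qed.

Lemma geo_end x y : geo x y (mdist x y) = y.
Proof. by rewrite /geo; case: cid => g /= []. Qed.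

Lemma geo_dist x y s t : 0 <= s <= mdist x y -> 0 <= t <= mdist x y ->
  mdist (geo x y s) (geo x y t) = `|s - t|.
Proof. by rewrite /geo; case: cid => g /= [_ _]; apply. Qed.

Lemma geo_distl x y s : 0 <= s <= mdist x y -> mdist x (geo x y s) = s.
Proof.
move=> hs; rewrite -{1}(geo0 x y) geo_dist ?lexx ?mdist_ge0//.
by case/andP: hs => hs _; rewrite sub0r normrN ger0_norm.
Qed.

Lemma geo_distr x y s : 0 <= s <= mdist x y ->
  mdist (geo x y s) y = mdist x y - s.
Proof.
move=> hs; rewrite -{2}(geo_end x y) geo_dist ?lexx ?mdist_ge0//.
by case/andP: hs => _ hs; rewrite distrC ger0_norm ?subr_ge0.
Qed.

Lemma geo_segment x y s : 0 <= s <= mdist x y -> segment x y (geo x y s).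
Proof. by move=> hs; rewrite /segment /= geo_distl// geo_distr// addrC subrK. Qed.

Lemma geoE x y z : segment x y z -> geo x y (mdist x z) = z.
Proof.
move=> hz.
have hs : 0 <= mdist x z <= mdist x y.
  rewrite mdist_ge0 /=; move: hz; rewrite /segment /= => <-.
  by rewrite lerDl mdist_ge0.
by apply: (segment_inj (geo_segment hs) hz); rewrite geo_distl.
Qed.

(** The Gromov product of [y] and [q] at [x]: the projection of [q] to the arc
    from [x] to [y] lies at this distance from [x]. *)
Definition proj_param x y q : R := (mdist x y + mdist x q - mdist y q) / 2.

Lemma proj_param_itv x y q : 0 <= proj_param x y q <= mdist x y.
Proof.
have t1 := metric_triangle y x q; have t2 := metric_triangle x y q.
by rewrite (metric_sym y x) in t1; rewrite /proj_param; apply/andP; split; lra.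
Qed.

Lemma proj_param_dist x y q :
  mdist q (geo x y (proj_param x y q))
    <= (mdist x q + mdist y q - mdist x y) / 2.
Proof.
have h := proj_param_itv x y q.
have := four_point q (geo x y (proj_param x y q)) x y.
rewrite (metric_sym (geo _ _ _) x) (geo_distl h) (geo_distr h).
by rewrite (metric_sym q x) (metric_sym q y) /proj_param; case; lra.
Qed.

Lemma median_exists x y q : exists c, 
  [/\ segment x y c, segment x q c & segment y q c].
Proof.
have h := proj_param_itv x y q; exists (geo x y (proj_param x y q)).
have hd := proj_param_dist x y q.
have t1 := metric_triangle x (geo x y (proj_param x y q)) q.
have t2 := metric_triangle y (geo x y (proj_param x y q)) q.
split; first exact: geo_segment.
  rewrite /segment /=; move: t1; rewrite (geo_distl h) (metric_sym (geo _ _ _) q).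
  by move: hd; rewrite /proj_param; lra.
rewrite /segment /=; move: t2; rewrite (metric_sym y (geo _ _ _)) (geo_distr h) (metric_sym (geo _ _ _) q).
by move: hd; rewrite /proj_param; lra.
Qed.

Lemma ball_convex x (e : R) : geod_convex [set z | mdist x z <= e].
Proof.
move=> p q /= hp hq z; rewrite /segment /= => hz.
have n1 := mdist_ge0 p z; have n2 := mdist_ge0 z q.
have := four_point x z p q; rewrite (metric_sym z p).
by case; lra.
Qed.

End TreeGeometry.

Section ActionGeometry.
Context {R : realType} {T : metricType R} {G : groupType}.
Hypothesis hT : real_tree T.
Variable rho : isom_action G T.
Implicit Types (g h k : G) (x y z : T).

Lemma actVK g x : rho g^-1%g (rho g x) = x.
Proof. by rewrite -actM mulVg act1. Qed.

Lemma actKV g x : rho g (rho g^-1%g x) = x.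
Proof. by rewrite -actM mulgV act1. Qed.

Lemma act_distl g x y : mdist (rho g^-1%g x) y = mdist x (rho g y).
Proof. by rewrite -(act_isom rho g) actKV. Qed.

Lemma act_segment g x y z : segment (rho g x) (rho g y) (rho g z) <-> segment x y z.
Proof. by rewrite /segment /= !act_isom. Qed.

Lemma act_geo g x y s : 0 <= s <= mdist x y ->
  rho g (geo hT x y s) = geo hT (rho g x) (rho g y) s.
Proof.
move=> hs; rewrite -{2}(geo_distl hT hs) -(act_isom rho g) geoE//.
by apply/act_segment; exact: geo_segment.
Qed.

Lemma fix_segment g x y z : rho g x = x -> rho g y = y -> segment x y z ->
  rho g z = z.
Proof.
move=> gx gy xyz; apply: (segment_inj hT _ xyz).
  by rewrite -{1}gx -{1}gy; apply/act_segment.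
by rewrite -{1}gx act_isom.
Qed.

End ActionGeometry.

(** * Branches of the Cayley tree of a free group *)

Section FreeGroup.
Context {N : nat} {F : groupType}.
Variable a : 'I_N -> F.
Hypothesis ha : free_basis a.
Implicit Types (g h u c : F) (w : seq (letter N)) (z : letter N).

Lemma word_val_nil : word_val a [::] = 1%g.
Proof. by rewrite /word_val big_nil. Qed.

Lemma word_val_cons z w : word_val a (z :: w) = (letter_val a z * word_val a w)%g.
Proof. by rewrite /word_val big_cons. Qed.

Lemma word_val_cat w w' : word_val a (w ++ w') = (word_val a w * word_val a w')%g.
Proof. by rewrite /word_val big_cat. Qed.

Lemma word_val_rcons w z : word_val a (rcons w z) = (word_val a w * letter_val a z)%g.
Proof. by rewrite -cats1 word_val_cat word_val_cons word_val_nil mulg1. Qed.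

Lemma word_val_take_nth z0 w j : (j < size w)%N ->
  word_val a (take j.+1 w) = (word_val a (take j w) * letter_val a (nth z0 w j))%g.
Proof. by move=> hj; rewrite (take_nth z0)// word_val_rcons. Qed.

Lemma reduced_take w j : reduced w -> reduced (take j w).
Proof. exact: take_sorted. Qed.

Lemma reduced_drop w j : reduced w -> reduced (drop j w).
Proof. exact: drop_sorted. Qed.

Lemma reduced_rcons w z z' :
  reduced (rcons (rcons w z) z') = reduced (rcons w z) && (z' != letter_inv z).
Proof.
by case: w => [|y w]; rewrite /reduced /= ?andbT// !rcons_path last_rcons.
Qed.

Lemma reduced_inv w : reduced (rev (map letter_inv w)) = reduced w.
Proof.
rewrite /reduced rev_sorted sorted_map; apply: eq_sorted => x y /=.
by rewrite letter_invK eq_sym.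
Qed.

Definition word_of g : seq (letter N) := projT1 (cid (ha g)).

Lemma word_of_reduced g : reduced (word_of g).
Proof. by rewrite /word_of; case: cid => w /= [[]]. Qed.

Lemma word_ofK g : word_val a (word_of g) = g.
Proof. by rewrite /word_of; case: cid => w /= [[]]. Qed.

Lemma word_of_val w : reduced w -> word_of (word_val a w) = w.
Proof. by rewrite /word_of; case: cid => w' /= [_ uni] rw; exact: uni. Qed.

Lemma word_of1 : word_of 1%g = [::].
Proof. by rewrite -word_val_nil word_of_val. Qed.

Definition first_letter g : option (letter N) := ohead (word_of g).

Lemma first_letter_val w : reduced w -> first_letter (word_val a w) = ohead w.
Proof. by move=> rw; rewrite /first_letter word_of_val. Qed.

(** The first letter of a vertex names the branch of the Cayley tree at the
    identity in which it lies, and only the identity separates branches. *)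
Lemma first_letter_step h z : h <> 1%g -> (h * letter_val a z)%g <> 1%g ->
  first_letter (h * letter_val a z)%g = first_letter h.
Proof.
have := word_of_reduced h; have := word_ofK h.
case/lastP: (word_of h) => [|w z'] <- rw h1 h2; first by rewrite word_val_nil in h1.
rewrite (first_letter_val rw).
have [e|ne] := eqVneq z (letter_inv z').
  have rw' : reduced w.
    by move: rw; rewrite -cats1 => /(reduced_take (size w)); rewrite take_size_cat.
  move: h2; rewrite word_val_rcons e letter_valV mulgK => h2.
  rewrite first_letter_val//; case: w h2 {rw rw' h1} => [|y w]//=.
  by rewrite word_val_nil.
rewrite -word_val_rcons first_letter_val; last by rewrite reduced_rcons rw.
by case: w {rw h1 h2}.
Qed.

Lemma word_val_neq1 w : reduced w -> w <> [::] -> word_val a w <> 1%g.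
Proof. by move=> rw + e; apply; rewrite -(word_of_val rw) e word_of1. Qed.

(** A pair [(g, i)] stands for the open edge from [g] to [g a_i] of the Cayley
    tree; [branch u e] is the component of the complement of the vertex [u]
    that contains the edge [e], named by the letter leading into it. *)
Definition branch_at1 h (i : 'I_N) : option (letter N) :=
  if h == 1%g then Some (i, false) else first_letter h.

Definition branch u (e : F * 'I_N) : option (letter N) :=
  branch_at1 (u^-1 * e.1)%g e.2.

Definition shift h (e : F * 'I_N) : F * 'I_N := ((h * e.1)%g, e.2).

Lemma shift1 e : shift 1 e = e.
Proof. by case: e => g i; rewrite /shift mul1g. Qed.

Lemma shiftM h h' e : shift (h * h')%g e = shift h (shift h' e).
Proof. by rewrite /shift mulgA. Qed.

Lemma branch_shift h u e : branch (h * u)%g (shift h e) = branch u e.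
Proof. by rewrite /branch /shift /= invgM -mulgA mulKg. Qed.

Definition edge_end (e : F * 'I_N) v : Prop := v = e.1 \/ v = (e.1 * a e.2)%g.

Lemma branch_edge_end u e v : edge_end e v -> u <> v ->
  branch u e = first_letter (u^-1 * v)%g.
Proof.
case: e => g i; rewrite /edge_end /branch /branch_at1 /= => -[->|->] uv.
  case: eqP => // e; case: uv; apply: esym.
  by rewrite -(mulVKg u g) e mulg1.
have ne : (u^-1 * (g * a i))%g <> 1%g.
  by move=> e; apply: uv; rewrite -(mulVKg u (g * a i))%g e mulg1.
case: eqP => [e|e].
  rewrite mulgA e mul1g (_ : a i = word_val a [:: (i, false)]).
    by rewrite first_letter_val.
  by rewrite word_val_cons word_val_nil mulg1.
rewrite mulgA (_ : a i = letter_val a (i, false))// first_letter_step//.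
by rewrite mulgA in ne.
Qed.

Lemma first_letter_path u g w :
  (forall j, (j <= size w)%N -> u <> (g * word_val a (take j w))%g) ->
  first_letter (u^-1 * g)%g = first_letter (u^-1 * (g * word_val a w))%g.
Proof.
elim: w g => [|z w IH] g hu; first by rewrite word_val_nil mulg1.
have h0 : u <> g by have := hu 0%N isT; rewrite take0 word_val_nil mulg1.
have h1 : u <> (g * letter_val a z)%g.
  by have := hu 1%N isT; rewrite /= take0 word_val_cons word_val_nil mulg1.
have nz h : u <> h -> (u^-1 * h)%g <> 1%g.
  by move=> uh e; apply: uh; rewrite -(mulVKg u h) e mulg1.
rewrite word_val_cons (mulgA g) -IH; last first.
  by move=> j hj; have := hu j.+1 hj; rewrite /= word_val_cons mulgA.
rewrite mulgA first_letter_step//; first exact: nz.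
by rewrite -mulgA; exact: nz.
Qed.

(** Branches at [u] do not change along a path that avoids [u].  In particular
    two edges are separated by finitely many vertices. *)
Lemma separators_on_path u e e' v v' w : edge_end e v -> edge_end e' v' ->
  v' = (v * word_val a w)%g -> branch u e <> branch u e' ->
  exists2 j, (j <= size w)%N & u = (v * word_val a (take j w))%g.
Proof.
move=> ev ev' vv' ne; apply: contrapT => no.
have hu j : (j <= size w)%N -> u <> (v * word_val a (take j w))%g.
  by move=> hj e1; apply: no; exists j.
apply: ne; rewrite (branch_edge_end ev) ?(branch_edge_end ev').
- by rewrite vv'; exact: first_letter_path.
- by rewrite vv' -[X in word_val a X](take_size w); exact: hu.
- by have := hu 0%N (leq0n _); rewrite take0 word_val_nil mulg1.
Qed.

(** The inverse of a generator crosses an edge backwards, so that this edge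
    starts at the vertex it leads to. *)
Definition letter_edge g z : F * 'I_N :=
  ((if z.2 then g * letter_val a z else g)%g, z.1).

Lemma letter_edge_end g z : edge_end (letter_edge g z) g.
Proof.
case: z => i [] /=; rewrite /edge_end /letter_edge /letter_val /=; last by left.
by right; rewrite mulgVK.
Qed.

Lemma branch1_letter_edge z0 w j : reduced w -> (j < size w)%N ->
  branch 1 (letter_edge (word_val a (take j w)) (nth z0 w j)) = ohead w.
Proof.
move=> rw hj; rewrite /branch invg1 mul1g /letter_edge /=.
case E : (nth z0 w j) => [i b] /=; case: b E => E.
  rewrite -E -word_val_take_nth// /branch_at1 ifF.
    by rewrite first_letter_val ?reduced_take//; case: w hj {rw E}.
  apply/eqP; apply: word_val_neq1; first exact: reduced_take.
  by case: w hj {rw E}.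
case: j hj E => [|j] hj E.
  rewrite take0 word_val_nil /branch_at1 eqxx.
  by case: w hj E {rw} => //= y w _ ->.
rewrite /branch_at1 ifF.
  by rewrite first_letter_val ?reduced_take//; case: w hj {rw E}.
apply/eqP; apply: word_val_neq1; first exact: reduced_take.
by case: w hj {rw E}.
Qed.

(** Free groups are torsion-free: if the reduced word of [g] begins and ends
    with inverse letters, conjugate [g] by the first one; otherwise the powers
    of the word are reduced. *)
Lemma torsion_free g n : g <> 1%g -> (g ^+ n.+1)%g <> 1%g.
Proof.
move: {2}(size (word_of g)).+1 (ltnSn (size (word_of g))) => m.
elim: m g => // m IH g sg g1 gn.
have rw := word_of_reduced g; have wg := word_ofK g.
case E : (word_of g) rw wg sg => [|z w] rw wg sg.
  by apply: g1; rewrite -wg word_val_nil.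
have [e|ne] := eqVneq (last z w) (letter_inv z).
  case/lastP: w E rw wg sg e => [|w z'] E rw wg sg.
    by move=> /= e; case: z e {E rw wg sg} => i [].
  rewrite last_rcons => e.
  have rw' : reduced w.
    move: rw => /path_sorted; rewrite -cats1 => /(reduced_take (size w)).
    by rewrite take_size_cat.
  have gE : g = (word_val a w ^ (letter_val a z)^-1)%g.
    by rewrite -wg word_val_cons word_val_rcons e letter_valV conjgE invgK mulgA.
  have w1 : word_val a w <> 1%g by move=> w1; apply: g1; rewrite gE w1 conj1g.
  apply: (IH (word_val a w)) => //.
    by rewrite word_of_val//; move: sg; rewrite /= size_rcons; lia.
  move: gn; rewrite gE -conjXg conjgE => gn.
  by apply: (mulIg (letter_val a z)^-1%g); apply: (mulgI ((letter_val a z)^-1)^-1%g); rewrite mul1g gn mulVg.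
have pw k : reduced (flatten (nseq k.+1 (z :: w))) /\
   word_val a (flatten (nseq k.+1 (z :: w))) = (g ^+ k.+1)%g.
  elim: k => [|k [IHk1 IHk2]]; first by rewrite /= cats0 wg expg1.
  split; last by rewrite -[nseq _ _]/((z :: w) :: _) /= -cat_cons word_val_cat wg IHk2 -expgS.
  move: IHk1; rewrite /reduced /= !cat_path /= cat_path => /andP[-> ->]; rewrite ?(andTb,andbT).
  apply: contra ne => /eqP e; apply/eqP.
  by rewrite [in RHS]e letter_invK.
have [r v] := pw n.
by apply: (word_val_neq1 r) => //; rewrite v.
Qed.

Lemma expg_inj c (i j : nat) : c <> 1%g -> (c ^+ i = c ^+ j)%g -> i = j.
Proof.
wlog ij : i j / (i <= j)%N.
  move=> W c1 e; case: (leqP i j) => h; first exact: W.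
  by apply: esym; apply: W; rewrite // ltnW.
move=> c1 e; apply/eqP; rewrite eqn_leq ij /= leqNgt; apply/negP => lt.
have : (c ^+ (j - i))%g = 1%g.
  by apply: (mulgI (c ^+ i)%g); rewrite mulg1 -expgnDr subnKC.
by case: (j - i)%N (subn_gt0 i j) => [|k] h; [rewrite lt in h|exact: torsion_free].
Qed.

(** The hypothesis says that the branch at [u] of the edge [c ^+ k e] is
    [n]-periodic in [k].  If it were not constant, [u] would separate
    infinitely many pairs of consecutive edges of this sequence, that is,
    infinitely many translates of [u] would lie on the path from [e] to
    [c e]. *)
Lemma separates_power c n u e : (c ^+ n)%g <> 1%g ->
  (forall k, branch ((c ^+ k)^-1 * u)%g (shift (c ^+ n)%g e) =
             branch ((c ^+ k)^-1 * u)%g e) ->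
  branch u (shift c e) = branch u e.
Proof.
move=> cn per; apply: contrapT => ne.
have perk (d : F) t : d = c \/ d = 1%g ->
    branch ((c ^+ (n * t)%N)^-1 * u)%g (shift d e) = branch u (shift d e).
  move=> hd; elim: t => [|t IHt]; first by rewrite muln0 expg0 invg1 mul1g.
  have cd : commute (c ^+ n)%g d.
    by case: hd => ->; [apply/commute_sym/commuteX|exact: commute1].
  rewrite -IHt mulnS expgnDr -(branch_shift (c ^+ n)%g) invgM -mulgA.
  have cc : commute (c ^+ n)%g (c ^+ (n * t))%g by exact/commuteX2/commute_refl.
  have -> : ((c ^+ n) * ((c ^+ (n * t))^-1 * ((c ^+ n)^-1 * u)) = (c ^+ (n * t))^-1 * u)%g.
    by rewrite !mulgA (commuteV cc) -!mulgA mulVKg.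
  rewrite -shiftM cd shiftM.
  have := per (n * t)%N.
  case: hd => ->; last by rewrite !shift1.
  move=> _; have := per (n * t).+1%N; rewrite expgS invgM -!mulgA.
  rewrite -(branch_shift c) -[X in _ = X -> _](branch_shift c).
  have -> : (c * ((c ^+ (n * t))^-1 * (c^-1 * u)) = (c ^+ (n * t))^-1 * u)%g.
    have cc' : commute c (c ^+ (n * t))%g by exact/commuteX/commute_refl.
    by rewrite !mulgA (commuteV cc') -!mulgA mulVKg.
  by [].
pose w := word_of (e.1^-1 * (c * e.1))%g.
(* The translates of [u] by the powers of [c ^+ n] are pairwise distinct and
   all lie on the path [w] from [e] to [c e]: more of them than vertices. *)
have onpath t : exists j : 'I_(size w).+1,
    ((c ^+ (n * t)%N)^-1 * u)%g = (e.1 * word_val a (take j w))%g.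
  have ne' : branch ((c ^+ (n * t)%N)^-1 * u)%g e <>
             branch ((c ^+ (n * t)%N)^-1 * u)%g (shift c e).
    rewrite (perk c t (or_introl erefl)).
    by have := perk 1%g t (or_intror erefl); rewrite shift1 => -> /esym.
  have := separators_on_path (w := w) (or_introl erefl) (or_introl erefl) _ ne'.
  rewrite word_ofK mulVKg => /(_ erefl) [j hj ->].
  by exists (Ordinal (hj : (j < (size w).+1)%N)).
pose f (t : 'I_(size w).+2) := projT1 (cid (onpath t)).
have fP (t : 'I_(size w).+2) : ((c ^+ (n * t)%N)^-1 * u)%g = (e.1 * word_val a (take (f t) w))%g.
  exact: projT2 (cid (onpath t)).
have finj : injective f.
  move=> t t' ft; apply: val_inj => /=; apply: (@expg_inj (c ^+ n)%g) => //.
  rewrite -!expgnA; apply: invg_inj; apply: (mulIg u).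
  by rewrite (fP t) (fP t') ft.
by have := leq_card f finj; rewrite !card_ord ltnn.
Qed.

End FreeGroup.

(** * Counting in graphs on intervals *)

(** The functions [chi k] turn the incidence matrix of the edges into a
    triangular matrix, so its rank, at most the number of vertices, is the
    number of edges. *)
Lemma triangular_count (Vt : eqType) (m : nat) (V : seq Vt)
    (v1 v2 : 'I_m -> Vt) (chi : 'I_m -> Vt -> bool) :
  (forall k, v1 k \in V) -> (forall k, v2 k \in V) ->
  (forall k, chi k (v1 k) <> chi k (v2 k)) ->
  (forall k j : 'I_m, (j < k)%N -> chi k (v1 j) = chi k (v2 j)) ->
  (m <= size V)%N.
Proof.
move=> V1 V2 chid chij.
pose X : 'M[rat]_(m, size V) := \matrix_(k, v) (chi k (tnth (in_tuple V) v))%:R.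
have iP (v : 'I_m -> Vt) (Vv : forall k, v k \in V) k : (index (v k) V < size V)%N.
  by rewrite index_mem.
pose B : 'M[rat]_(size V, m) := \matrix_(v, j)
  ((v == Ordinal (iP _ V1 j))%:R - (v == Ordinal (iP _ V2 j))%:R).
have sumE (f : 'I_(size V) -> rat) i : \sum_v f v * (v == i)%:R = f i.
  rewrite (bigD1 i)//= eqxx mulr1 big1 ?addr0// => j /negPf ->.
  by rewrite mulr0.
have XB k j : (X *m B) k j = (chi k (v1 j))%:R - (chi k (v2 j))%:R.
  rewrite mxE; under eq_bigr => v _ do rewrite !mxE mulrBr.
  rewrite big_split /= sumrN !sumE.
  by rewrite !(tnth_nth (v1 j)) /= !nth_index.
have full : \rank (X *m B) = m.
  apply: mxrank_unit; rewrite unitmxE -det_tr det_trig.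
    rewrite unitfE; apply/prodf_neq0 => k _; rewrite mxE XB.
    by have := chid k; case: (chi k _) => //; case: (chi k _).
  apply/is_trig_mxP => i j ij; rewrite mxE XB chij// subrr.
  by [].
by rewrite -{1}full; apply: leq_trans (mxrankM_maxl _ _) (rank_leq_col _).
Qed.

(** A sequence that keeps doubling outgrows every polynomial. *)
Lemma polynomial_not_doubling (u : nat -> nat) (m : nat) : (0 < u 0)%N ->
  (forall n, u n <= (2 * n + 1) ^ m)%N -> exists n, (u n.+1 <= 2 * u n)%N.
Proof.
move=> u0 um; apply: contrapT => no.
have dbl n : (2 ^ n <= u n)%N.
  elim: n => // n IH; rewrite expnS.
  case: (leqP (u n.+1) (2 * u n)) => h; first by case: no; exists n.
  by apply: leq_trans (ltnW h); rewrite leq_mul2l.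
(* For [n = 2 ^ (3 * r)] the bound [(2 * n + 1) ^ m] is at most
   [2 ^ ((3 * r + 2) * m)], and the cube of [2 ^ r] beats this exponent. *)
have [r [r1 rm]] : exists r, (0 < r)%N /\ (m + 2 <= r)%N by exists (m + 2)%N; lia.
pose q := (3 * r)%N.
have := leq_trans (dbl (2 ^ q)%N) (um (2 ^ q)%N).
have b1 : (2 * 2 ^ q + 1 <= 2 ^ (q + 2))%N.
  by rewrite expnD; have := expn_gt0 2 q; lia.
have b2 : ((2 * 2 ^ q + 1) ^ m <= 2 ^ ((q + 2) * m))%N.
  rewrite expnM; case: (m) => [|m1]; first by rewrite !expn0.
  by rewrite leq_exp2r.
have b3 : ((q + 2) * m < 2 ^ q)%N.
  have lt : (r < 2 ^ r)%N by exact: ltn_expl.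
  have X3 : (r.+1 ^ 3 <= (2 ^ r) ^ 3)%N by rewrite leq_exp2r.
  by apply: leq_trans (_ : r.+1 ^ 3 <= _)%N; rewrite /q ?(mulnC 3%N) ?expnM // !expnS expn0; nia.
move=> h; have := leq_trans h b2; rewrite leq_exp2l//; lia.
Qed.

Section Average.
Context {R : realType}.
Local Open Scope ereal_scope.

(** Integrate the pointwise inequality between the numbers of intervals of the
    two families that contain a given point. *)
Lemma interval_average (I J : finType) (p q : I -> R) (p' q' : J -> R)
    (Z : set R) (c : nat) : (forall i, p i <= q i)%R ->
  (forall j, p' j <= q' j)%R -> countable Z ->
  (forall x, ~ Z x -> (#|[pred i | (p i < x < q i)%R]| <=
     c * #|[pred j | (p' j <= x <= q' j)%R]|)%N) ->
  (\sum_i (q i - p i) <= c%:R * \sum_j (q' j - p' j))%R.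
Proof.
move=> pq pq' cZ h.
pose mu := @lebesgue_measure R.
pose f (x : measurableTypeR R) : \bar R := \sum_(i : I) (\1_(`]p i, q i[%classic) x)%:E.
pose g (x : measurableTypeR R) : \bar R := \sum_(j : J) (\1_(`[p' j, q' j]%classic) x)%:E.
have mf : measurable_fun setT f.
  by apply: emeasurable_sum => i; apply/measurable_EFinP; exact: measurable_indic.
have mg : measurable_fun setT g.
  by apply: emeasurable_sum => i; apply/measurable_EFinP; exact: measurable_indic.
have intf : \int[mu]_x f x = (\sum_i (q i - p i))%:E.
  rewrite /f ge0_integral_sum//; last first.
    by move=> i; apply/measurable_EFinP; exact: measurable_indic.
  rewrite -sumEFin; apply: eq_bigr => i _.
  rewrite integral_indic// setIT.
  have H := lebesgue_measure_itv `]p i, q i[; apply: eq_trans H _; rewrite /= lte_fin.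
  case: ifPn => // /negP hpq.
  by congr EFin; apply/eqP; rewrite eq_sym subr_eq0 eq_le pq andbT leNgt; apply/negP.
have intg : \int[mu]_x g x = (\sum_j (q' j - p' j))%:E.
  rewrite /g ge0_integral_sum//; last first.
    by move=> i; apply/measurable_EFinP; exact: measurable_indic.
  rewrite -sumEFin; apply: eq_bigr => i _.
  rewrite integral_indic// setIT.
  have H := lebesgue_measure_itv `[p' i, q' i]; apply: eq_trans H _; rewrite /= lte_fin.
  case: ifPn => // /negP hpq.
  by congr EFin; apply/eqP; rewrite eq_sym subr_eq0 eq_le pq' andbT leNgt; apply/negP.
have g0 x : 0 <= g x by apply: sume_ge0 => j _; rewrite lee_fin.
have f0 x : 0 <= f x by apply: sume_ge0 => j _; rewrite lee_fin.
have cardE (K : finType) (P : pred K) (x : measurableTypeR R) (A : K -> set (measurableTypeR R)) :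
    (forall k, (x \in A k) = P k) ->
    \sum_(k : K) (\1_(A k) x)%:E = (#|P|%:R : R)%:E.
  move=> AP; rewrite sumEFin; congr EFin.
  under eq_bigr => k _ do rewrite indicE AP.
  rewrite -sum1_card natr_sum [RHS]big_mkcond; apply: eq_bigr => k _.
  by rewrite unfold_in; case: (P k).
have le : \int[mu]_x f x <= \int[mu]_x (c%:R%:E * g x).
  apply: ae_ge0_le_integral => //.
  - by move=> x _; rewrite mule_ge0.
  - exact: measurable_funeM.
  exists Z; split=> //.
  - exact: countable_measurable.
  - exact: countable_lebesgue_measure0.
  move=> x /= nx; apply: contrapT => Zx; apply: nx => _.
  rewrite /f /g (cardE _ [pred i | (p i < x < q i)%R]); last first.
    move=> i; apply/idP/idP => [/set_mem|hi]; first by rewrite /= in_itv.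
    by apply/mem_set; rewrite /= in_itv.
  rewrite (cardE _ [pred i | (p' i <= x <= q' i)%R]); last first.
    move=> i; apply/idP/idP => [/set_mem|hi]; first by rewrite /= in_itv.
    by apply/mem_set; rewrite /= in_itv.
  by rewrite -EFinM -natrM lee_fin ler_nat; exact: h.
move: le; rewrite intf ge0_integralZl//.
by rewrite intg -EFinM lee_fin.
Qed.
End Average.

Section IntervalGraph.
Context {R : realType}.

(** Boxes in the group generated by the [al j].  Combinations with the same
    value are counted once, since the [al j] may satisfy relations. *)
Definition lattice_box m (al : 'I_m -> R) (n : nat) : seq R :=
  undup [seq \sum_j al j *~ ((k j)%:Z - n%:Z) |
           k : {ffun 'I_m -> 'I_(2 * n).+1} <- enum {: {ffun 'I_m -> 'I_(2 * n).+1}}].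

Lemma mem_lattice_box m (al : 'I_m -> R) n l : l \in lattice_box al n <->
  exists k : 'I_m -> int, (forall j, - n%:Z <= k j <= n%:Z) /\
    l = \sum_j al j *~ k j.
Proof.
rewrite mem_undup; split=> [/mapP[k _ ->]|[k [kn ->]]].
  exists (fun j => (k j)%:Z - n%:Z); split=> // j.
  by have := ltn_ord (k j); lia.
apply/mapP; exists [ffun j => inord (absz (k j + n%:Z))]; first by rewrite mem_enum.
apply: eq_bigr => j _; congr (_ *~ _); rewrite ffunE inordK; have := kn j; lia.
Qed.

Lemma size_lattice_box m (al : 'I_m -> R) n :
  (size (lattice_box al n) <= (2 * n + 1) ^ m)%N.
Proof.
apply: leq_trans (size_undup _) _.
by rewrite size_map -cardE card_ffun !card_ord addn1.
Qed.

Lemma lattice_box_step m (al : 'I_m -> R) n (b : bool) l j :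
  l \in lattice_box al n ->
  al j + (if b then - l else l) \in lattice_box al n.+1.
Proof.
move=> /mem_lattice_box [k [kn ->]]; apply/mem_lattice_box.
exists (fun i => (i == j)%:Z + (if b then - k i else k i)); split.
  by move=> i; have := kn i; case: (i == j); case: b; lia.
under [RHS]eq_bigr => i _ do rewrite mulrzDr.
rewrite big_split /=; congr (_ + _).
  rewrite (bigD1 j)//= eqxx mulr1z big1 ?addr0// => i /negPf ->.
  by rewrite mulr0z.
case: b; last by [].
by rewrite -sumrN; apply: eq_bigr => i _; rewrite mulrNz.
Qed.

(** An isometry of the line, orientation-reversing when [e.1] holds. *)
Definition signed_shift (e : bool * R) (x : R) : R :=
  if e.1 then - x + e.2 else x + e.2.

(** The translations by the [alpha] generate an abelian group, which has
    polynomial growth; so some box of this group does not double its size when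
    enlarged by one step.  View the points of (0, C) as edges of a graph, with
    ends [v1 s] and [v2 s]: the images of a base point under that box, with or
    without the reflection, are edges whose ends are images of the base point
    under the enlarged box.  This is a finite subgraph, to which the hypothesis
    on numbers applies for all but countably many base points; averaging over
    the base point turns numbers of points into lengths of intervals.  One
    factor 2 comes from the hypothesis, the other from the growth of the box. *)
Lemma interval_graph_bound N (C : R) (ell : 'I_N -> R) (al : seq R) (Z : set R)
    (v1 v2 : R -> 'I_N * R) :
  0 <= C -> (forall i, 0 <= ell i) -> countable Z ->
  (forall s v, 0 < s < C -> ~ Z s -> v = v1 s \/ v = v2 s ->
     0 <= v.2 <= ell v.1 /\
     exists2 alpha, alpha \in al & v.2 = s + alpha \/ v.2 = - s + alpha) ->
  (forall (E : seq R) (V : seq ('I_N * R)), sorted <%R E ->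
     {in E, forall s, [/\ 0 < s < C, ~ Z s, v1 s \in V & v2 s \in V]} ->
     (size E <= 2 * size V)%N) ->
  C <= 4 * \sum_i ell i.
Proof.
move=> C0 ell0 cZ hv hE.
pose A (j : 'I_(size al)) := nth 0 al j.
have box0 : (0 < size (lattice_box A 0))%N.
  have : 0 \in lattice_box A 0.
    apply/mem_lattice_box; exists (fun=> 0); split=> [j|]; first by rewrite lexx.
    by rewrite big1// => j _; rewrite mulr0z.
  by case: lattice_box.
have [n hn] := polynomial_not_doubling box0 (size_lattice_box A).
pose L := lattice_box A n; pose L' := lattice_box A n.+1.
have uL : uniq L by exact: undup_uniq.
have L0 : (0 < size L)%N.
  have : 0 \in L.
    apply/mem_lattice_box; exists (fun=> 0); split=> [j|]; first by lia.
    by rewrite big1// => j _; rewrite mulr0z.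
  by case: L {uL}.
pose phi (M : seq R) (i : bool * 'I_(size M)) := signed_shift (i.1, tnth (in_tuple M) i.2).
pose lo (M : seq R) (c : R) (i : bool * 'I_(size M)) : R :=
  if i.1 then tnth (in_tuple M) i.2 - c else - tnth (in_tuple M) i.2.
have phi_oo M c i x : (0 < phi M i x < c) = (lo M c i < x < lo M c i + c).
  rewrite /phi /lo /signed_shift /=; case: i.1 => /=;
    by apply/idP/idP => /andP[h1 h2]; apply/andP; split; lra.
have phi_cc M c i x : (0 <= phi M i x <= c) = (lo M c i <= x <= lo M c i + c).
  rewrite /phi /lo /signed_shift /=; case: i.1 => /=;
    by apply/idP/idP => /andP[h1 h2]; apply/andP; split; lra.
pose inv (i : bool * 'I_(size L)) (y : R) : R :=
  if i.1 then tnth (in_tuple L) i.2 - y else y - tnth (in_tuple L) i.2.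
have invK i x : inv i (phi L i x) = x.
  by rewrite /inv /phi /signed_shift /=; case: i.1; lra.
(* Base points [x] for which some [s = phi L i x] is exceptional, or for which
   two of these values coincide. *)
pose Z' : set R :=
  \bigcup_(i : bool * 'I_(size L)) [set inv i z | z in Z] `|`
  \bigcup_(k : 'I_(size L) * 'I_(size L))
     [set (tnth (in_tuple L) k.1 - tnth (in_tuple L) k.2) / 2].
have cZ' : countable Z'.
  have -> : Z' = \bigcup_(b in [set: bool]) (if b then
    \bigcup_(i : bool * 'I_(size L)) [set inv i z | z in Z] else
    \bigcup_(k : 'I_(size L) * 'I_(size L))
      [set (tnth (in_tuple L) k.1 - tnth (in_tuple L) k.2) / 2]).
    apply/seteqP; split=> x; first by case=> h; [exists true|exists false].
    by move=> [[] _ h]; [left|right].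
  apply: bigcup_countable; first exact: countableP.
  move=> [] _; apply: bigcup_countable; try exact: countableP.
  - move=> i _; exact: sub_countable (card_image_le _ _) cZ.
  - by move=> k _; apply: finite_set_countable; exact: finite_set1.
have avg x : ~ Z' x ->
    (#|[pred i | (lo L C i < x < lo L C i + C)%R]| <=
     2 * #|[pred j : 'I_N * (bool * 'I_(size L')) |
            (lo L' (ell j.1) j.2 <= x <= lo L' (ell j.1) j.2 + ell j.1)%R]|)%N.
  move=> Zx.
  set P := [pred i | _]; set Q := [pred j | _].
  have phi_inj : injective (fun i => phi L i x).
    move=> i j e; case: i j e => [b k] [b' k'].
    rewrite /phi /signed_shift /=; case: (eqVneq b b') => [<-|ne].
      move=> e; congr (_, _).
      have : tnth (in_tuple L) k = tnth (in_tuple L) k' by case: b e => e; lra.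
      rewrite !(tnth_nth 0) /= => /eqP.
      by rewrite nth_uniq// => /eqP kk; apply: val_inj.
    move=> e; case: Zx; right.
    case: b b' ne e => [] [] // _ e; [exists (k, k')|exists (k', k)] => //=;
      by lra.
  pose E := sort <=%R [seq phi L i x | i <- enum P].
  pose V := [seq (j.1, phi L' j.2 x) | j <- enum Q].
  have -> : #|P| = size E by rewrite size_sort size_map cardE.
  have -> : #|Q| = size V by rewrite size_map cardE.
  have EP s : s \in E -> exists2 i, s = phi L i x & 0 < phi L i x < C.
    by rewrite mem_sort => /mapP[i]; rewrite mem_enum inE -phi_oo => h ->; exists i.
  apply: hE.
    rewrite lt_sorted_uniq_le sort_le_sorted andbT sort_uniq map_inj_uniq//.
    exact: enum_uniq.
  move=> s /EP [i -> si].
  have Zs : ~ Z (phi L i x).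
    by move=> Zs; apply: Zx; left; exists i => //; exists (phi L i x).
  have VP v : v = v1 (phi L i x) \/ v = v2 (phi L i x) -> v \in V.
    move=> hvv; have [v_in [alpha ia va]] := hv _ _ si Zs hvv.
    (* An end of an edge in the orbit of the box [L] lies in that of [L']. *)
    have [j hj] : exists j, v.2 = phi L' j x.
      have ja : (index alpha al < size al)%N by rewrite index_mem.
      have step b := @lattice_box_step _ A n b (tnth (in_tuple L) i.2) (Ordinal ja)
        (mem_tnth _ _).
      have Aa : A (Ordinal ja) = alpha by rewrite /A /= nth_index.
      rewrite Aa in step.
      have get l (b : bool) : l \in L' -> exists j, signed_shift (b, l) x = phi L' j x.
        move=> hl; have jl : (index l L' < size L')%N by rewrite index_mem.
        by exists (b, Ordinal jl); rewrite /phi (tnth_nth 0) /= nth_index.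
      case: va => ->.
        have [j hj] := get _ i.1 (step false); exists j; rewrite -hj.
        by rewrite /phi /signed_shift /=; case: i.1; lra.
      have [j hj] := get _ (~~ i.1) (step true); exists j; rewrite -hj.
      by rewrite /phi /signed_shift /=; case: i.1 => /=; lra.
    apply/mapP; exists (v.1, j); last by rewrite /= -hj; case: (v).
    by rewrite mem_enum inE /= -phi_cc -hj.
  by split=> //; apply: VP; [left|right].
have := interval_average (p := lo L C) (q := fun i => lo L C i + C)
  (p' := fun j : 'I_N * (bool * 'I_(size L')) => lo L' (ell j.1) j.2)
  (q' := fun j => lo L' (ell j.1) j.2 + ell j.1) _ _ cZ' avg.
have h1 i : lo L C i <= lo L C i + C by rewrite lerDl.
have h2 (j : 'I_N * (bool * 'I_(size L'))) :
    lo L' (ell j.1) j.2 <= lo L' (ell j.1) j.2 + ell j.1 by rewrite lerDl.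
move=> /(_ h1 h2).
under eq_bigr => i _ do rewrite addrAC subrr add0r.
under [X in _ <= _ * X -> _]eq_bigr => i _ do rewrite addrAC subrr add0r.
rewrite -(pair_big xpredT xpredT (fun i (_ : bool * 'I_(size L')) => ell i)) /=.
under [X in _ <= _ * X -> _]eq_bigr => i _ do rewrite sumr_const card_prod card_bool card_ord.
rewrite sumr_const card_prod card_bool card_ord sumrMnl => H.
have S0 : 0 <= \sum_i ell i by apply: sumr_ge0.
have hnR : (size L')%:R <= 2 * (size L)%:R :> R by rewrite -natrM ler_nat.
have L0R : 0 < (size L)%:R :> R by rewrite ltr0n.
move: H; rewrite -[C *+ _]mulr_natr -[_ *+ (2 * size L')]mulr_natr !natrM => H.
rewrite -(ler_pM2r L0R); nra.
Qed.
End IntervalGraph.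

(** * Folding and bounded backtracking *)

Definition cyclic_arc_stabilizers {R : realType} {G : groupType}
    {T : metricType R} (rho : isom_action G T) : Prop :=
  forall p q : T, p <> q -> exists c : G, [/\ rho c p = p, rho c q = q &
    forall k, rho k p = p -> rho k q = q -> cyclic_subgroup c k].

Lemma very_small_cyclic_arcs {R : realType} {G : groupType} {T : metricType R}
    (hT : real_tree T) (rho : isom_action G T) :
  very_small rho -> cyclic_arc_stabilizers rho.
Proof.
move=> [arcs _] p q pq.
have stab k : rho k p = p -> rho k q = q -> pointwise_stab rho (segment p q) k.
  by move=> kp kq z; exact: (fix_segment hT).
have fixends k : pointwise_stab rho (segment p q) k -> rho k p = p /\ rho k q = q.
  by move=> h; split; apply: h; [exact: segmentl|exact: segmentr].
case: (arcs p q pq) => [e|[[c e] _]].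
  exists 1%g; split; rewrite ?act1// => k kp kq.
  have := stab k kp kq; rewrite e => ->; exists 0%N; left; by rewrite expg0.
have /fixends[cp cq] : pointwise_stab rho (segment p q) c.
  by rewrite e; exists 1%N; left; rewrite expg1.
by exists c; split=> // k kp kq; rewrite -e; exact: stab.
Qed.

Section Folding.
Context {R : realType} {T : metricType R} {N : nat} {F : groupType}.
Hypothesis hT : real_tree T.
Variable rho : isom_action F T.
Variable a : 'I_N -> F.
Hypothesis ha : free_basis a.
Hypothesis hcyc : cyclic_arc_stabilizers rho.
Variable o : T.
Implicit Types (g h k u c : F) (e : F * 'I_N) (w : seq (letter N)).

Local Notation wv := (word_val a).
Local Notation branch := (branch ha).

Definition edge_length (i : 'I_N) : R := mdist o (rho (a i) o).

(** The point at distance [x] from the origin of the image of an edge under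
    the map from the Cayley tree to [T] that sends [g] to [g o]. *)
Definition edge_point e (x : R) : T := rho e.1 (geo hT o (rho (a e.2) o) x).

Lemma edge_point_shift h e x : edge_point (shift h e) x = rho h (edge_point e x).
Proof. by rewrite /edge_point /= actM. Qed.

(** All vertices of the path between the two edges in the Cayley tree have
    their images in the open ball of radius [s] about [y].  Speaking of
    separating vertices instead of paths makes it plain that this is an
    equivalence relation.  Points of the two edges over the same point [y] are
    identified by folding before time [s]. *)
Definition linked (y : T) (s : R) e e' : Prop :=
  forall u, branch u e <> branch u e' -> mdist (rho u o) y < s.

Lemma linked_refl y s e : linked y s e e.
Proof. by move=> u. Qed.

Lemma linked_sym y s e e' : linked y s e e' -> linked y s e' e.
Proof. by move=> h u /nesym; exact: h. Qed.

Lemma linked_trans y s e e' e'' :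
  linked y s e e' -> linked y s e' e'' -> linked y s e e''.
Proof.
move=> h h' u; case: (pselect (branch u e = branch u e')) => [->|ne _].
  exact: h'.
exact: h.
Qed.

Lemma linked_shift h y s e e' :
  linked y s e e' -> linked (rho h y) s (shift h e) (shift h e').
Proof.
move=> l u; rewrite -{1 2}(mulVKg h u) !branch_shift => /l.
by rewrite actM act_distl.
Qed.

Lemma linked_fix h y s e e' : rho h y = y ->
  linked y s e e' -> linked y s (shift h e) (shift h e').
Proof. by move=> hy l; rewrite -hy; exact: linked_shift. Qed.

Lemma linked_expg y s c e n : rho c y = y ->
  linked y s e (shift c e) -> linked y s e (shift (c ^+ n)%g e).
Proof.
move=> cy l; elim: n => [|n IH]; first by rewrite expg0 shift1; exact: linked_refl.
by rewrite expgS shiftM; apply: linked_trans l _; exact: linked_fix.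
Qed.

Lemma fix_expg c (y : T) n : rho c y = y -> rho (c ^+ n)%g y = y.
Proof.
by move=> cy; elim: n => [|n IH]; rewrite ?expg0 ?act1// expgS actM IH.
Qed.

Lemma fix_invg c (y : T) : rho c y = y -> rho c^-1%g y = y.
Proof. by move=> cy; rewrite -{1}cy actVK. Qed.

(** If a vertex [u] outside the ball separated [e] from [c e], so would, for
    [e] and [c ^+ n e], some translate of [u] by a power of [c]
    ([separates_power]); this translate is outside the ball too, as [c] fixes
    the center. *)
Lemma linked_root y s c e n : rho c y = y -> (c ^+ n)%g <> 1%g ->
  linked y s e (shift (c ^+ n)%g e) -> linked y s e (shift c e).
Proof.
move=> cy cn l u ne; rewrite ltNge; apply/negP => far.
apply: ne; apply: esym; apply: (separates_power (ha := ha) cn) => k.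
apply: contrapT => /nesym /l; rewrite actM act_distl (fix_expg _ cy).
by rewrite ltNge far.
Qed.

Lemma linked_cyclic y s c e k k' : rho c y = y -> cyclic_subgroup c k ->
  cyclic_subgroup c k' -> k <> 1%g ->
  linked y s e (shift k e) -> linked y s e (shift k' e).
Proof.
move=> cy [n kE] [m k'E] k1 l.
have ln : linked y s e (shift (c ^+ n)%g e) /\ (c ^+ n)%g <> 1%g.
  case: kE => kE; first by rewrite -kE.
  split; last by move=> cn; apply: k1; rewrite kE cn invg1.
  have := linked_fix (fix_expg n cy) l; rewrite kE -shiftM mulgV shift1.
  exact: linked_sym.
have lm := linked_expg (n := m) cy (linked_root cy ln.2 ln.1).
case: k'E => -> //.
have := linked_fix (fix_invg (fix_expg m cy)) lm; rewrite -shiftM mulVg shift1.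
exact: linked_sym.
Qed.

Lemma edge_end_segment g z : let e := letter_edge a g z in
  forall p, segment (rho g o) (rho (g * letter_val a z)%g o) p ->
  segment (rho e.1 o) (rho (e.1 * a e.2)%g o) p.
Proof.
case: z => i [] p //=; rewrite /letter_edge /letter_val /= mulgVK.
exact: segment_sym.
Qed.

Lemma edge_pointE e p : segment (rho e.1 o) (rho (e.1 * a e.2)%g o) p ->
  0 <= mdist (rho e.1 o) p <= edge_length e.2 /\
  edge_point e (mdist (rho e.1 o) p) = p.
Proof.
move=> seg.
have le : 0 <= mdist (rho e.1 o) p <= edge_length e.2.
  rewrite mdist_ge0 /= (_ : edge_length _ = mdist (rho e.1 o) (rho (e.1 * a e.2)%g o)).
    by move: seg; rewrite /segment /= => <-; rewrite lerDl mdist_ge0.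
  by rewrite /edge_length actM act_isom.
split=> //; rewrite /edge_point act_geo// -actM; exact: geoE.
Qed.

(** If [p] is the point at distance [s] from [o] on the arc from [o] to [y], its
    distance to a vertex [q] is either [d(o, q) - s], when [p] lies between [o]
    and [q], or [d(q, y) - d(o, y) + s], when it lies between [q] and [y]. *)
Definition coordinate_shifts (y : T) w : seq R :=
  flatten [seq [:: mdist o (rho (wv (take j w)) o);
                   mdist (rho (wv (take j w)) o) y - mdist o y]
          | j <- iota 0 (size w).+1].

(** What is used of the first edge [e] of the path [w] whose image meets, at the
    coordinate [x], the point at distance [s] from [o] on the arc from [o] to
    [y]: in particular the vertices of [w] that precede [e] are within [s] of
    this point. *)
Definition crossing (y : T) w (s : R) e (x : R) : Prop :=
  [/\ edge_point e x = geo hT o y s, 0 <= x <= edge_length e.2,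
      branch 1%g e = ohead w,
      exists j, edge_end a e (wv (take j w)) /\
        forall j', (j' <= j)%N ->
          mdist (rho (wv (take j' w)) o) (geo hT o y s) <= s &
      exists2 alpha, alpha \in coordinate_shifts y w &
        x = s + alpha \/ x = - s + alpha].

(** Before [w] first meets the point at distance [s], its vertices are separated
    by this point from [y]; being within [d(o, y)] of [y], they are within [s]
    of the point. *)
Lemma crossing_exists y w s : reduced w -> segment o (rho (wv w) o) y ->
  (forall j, segment o (rho (wv (take j w)) o) y \/
     mdist (rho (wv (take j w)) o) y <= mdist o y) ->
  0 < s < mdist o y -> exists e x, crossing y w s e x.
Proof.
move=> rw wy low /andP[s0 sC].
have sI : 0 <= s <= mdist o y by rewrite !ltW.
pose p := geo hT o y s; pose q j := rho (wv (take j w)) o.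
have op : mdist o p = s by exact: geo_distl.
have yp : segment o y p by exact: geo_segment.
(* The edge sought ends at the first vertex that the point [p] separates from
   [o]. *)
have hits : exists j, `[< segment o (q j) p >].
  exists (size w); apply/asboolP; rewrite /q take_size.
  exact: segment_trans wy yp.
pose m := ex_minn hits.
have [hm mmin] : segment o (q m) p /\ forall j, segment o (q j) p -> (m <= j)%N.
  rewrite /m; case: ex_minnP => m' /asboolP h h'; split=> // j hj.
  by apply: h'; apply/asboolP.
have m0 : (0 < m)%N.
  rewrite lt0n; apply/eqP => e; move: hm; rewrite e /q take0 word_val_nil act1.
  rewrite /segment /= op (metric_sym p) op mdistxx; lra.
have msz : (m <= size w)%N.
  by apply: mmin; rewrite /q take_size; exact: segment_trans wy yp.
have [j mj] : exists j, m = j.+1 by case: (m) m0 => // j _; exists j.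
have jsz : (j < size w)%N by rewrite -mj.
have before j' : (j' <= j)%N -> segment (q j') y p.
  move=> j'j; case: (segment_split hT (q j') yp) => // h.
  by have := mmin _ h; rewrite mj ltnNge j'j.
have near j' : (j' <= j)%N -> mdist (q j') p <= s.
  move=> j'j; have h := before _ j'j.
  have : mdist (q j') y <= mdist o y.
    case: (low j') => // h'; have := mmin _ (segment_trans h' yp).
    by rewrite mj ltnNge j'j.
  have := geo_distr hT sI; move: h; rewrite /segment /= -/p; lra.
have [i0 _] : exists i : 'I_N, True.
  by case: w jsz {rw wy low q hits m hm mmin m0 msz mj before near} => // -[i b] w _; exists i.
pose z := nth (i0, false) w j.
have qS : q j.+1 = rho (wv (take j w) * letter_val a z)%g o.
  by rewrite /q (word_val_take_nth a (i0, false))//.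
have seg : segment (q j) (q j.+1) p.
  rewrite mj in hm; case: (segment_split hT (q j) hm) => // h.
  by have := mmin _ h; rewrite mj ltnn.
rewrite qS in seg; have {}seg := edge_end_segment seg.
have [xI xp] := edge_pointE seg.
set e := letter_edge a _ _ in xI xp.
exists e, (mdist (rho e.1 o) p); split=> //.
- exact: (branch1_letter_edge ha).
- by exists j; split=> //; exact: letter_edge_end.
have [j' j'w eE] : exists2 j', (j' <= size w)%N & rho e.1 o = q j'.
  rewrite /e /letter_edge; case: z.2 => /=; last by exists j => //; exact: ltnW.
  by exists j.+1 => //; rewrite qS.
have mem al : al \in [:: mdist o (q j'); mdist (q j') y - mdist o y] ->
    al \in coordinate_shifts y w.
  move=> h; apply/flatten_mapP; exists j' => //.
  by rewrite mem_iota add0n ltnS.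
rewrite eE; case: (segment_split hT (q j') yp) => h.
  exists (mdist o (q j')); first by apply: mem; rewrite inE eqxx.
  by right; move: h; rewrite /segment /= op (metric_sym p); lra.
exists (mdist (q j') y - mdist o y); first by apply: mem; rewrite !inE eqxx orbT.
by left; have := geo_distr hT sI; move: h; rewrite /segment /= -/p; lra.
Qed.

Lemma countable_group : countable [set: F].
Proof.
have -> : [set: F] = [set wv w | w in [set: seq (letter N)]].
  by apply/seteqP; split=> // g _; exists (word_of ha g); rewrite ?word_ofK.
exact: sub_countable (card_image_le _ _) (countableP _).
Qed.

Lemma countable_subsingleton (A : set R) :
  (forall x y, A x -> A y -> x = y) -> countable A.
Proof.
move=> uni; case: (pselect (A !=set0)) => [[x Ax]|/set0P/negP/negPn/eqP ->].
  apply: (@sub_countable _ _ _ [set x]).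
    by apply: subset_card_le => y Ay; exact: uni.
  exact: finite_set_countable (finite_set1 x).
exact: countable0.
Qed.

(** For all but countably many points of an arc, any two elements that fix the
    point lie in a common cyclic group fixing it: an element that fixes a point
    also fixes an arc around it unless the point is an end of the fixed part. *)
Lemma generic_stabilizers y : exists2 Z : set R, countable Z &
  forall s, 0 < s < mdist o y -> ~ Z s -> forall k k',
    rho k (geo hT o y s) = geo hT o y s -> rho k' (geo hT o y s) = geo hT o y s ->
    exists c, [/\ rho c (geo hT o y s) = geo hT o y s, cyclic_subgroup c k &
                  cyclic_subgroup c k'].
Proof.
pose J := geo hT o y.
(* The exceptional points are the ends of the subarcs fixed by single
   elements. *)
pose fixed k s := 0 < s < mdist o y /\ rho k (J s) = J s.
pose Zlo k := [set s | fixed k s /\ forall s', fixed k s' -> s <= s'].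
pose Zhi k := [set s | fixed k s /\ forall s', fixed k s' -> s' <= s].
exists ((\bigcup_(k in [set: F]) Zlo k) `|` \bigcup_(k in [set: F]) Zhi k).
  have c1 : countable (\bigcup_(k in [set: F]) Zlo k).
    apply: bigcup_countable; first exact: countable_group.
    move=> k _; apply: countable_subsingleton => x x' [fx lx] [fx' lx'].
    by apply/eqP; rewrite eq_le lx// lx'.
  have c2 : countable (\bigcup_(k in [set: F]) Zhi k).
    apply: bigcup_countable; first exact: countable_group.
    move=> k _; apply: countable_subsingleton => x x' [fx lx] [fx' lx'].
    by apply/eqP; rewrite eq_le lx// lx'.
  rewrite -bigcup2E; apply: bigcup_countable; first exact: countableP.
  by move=> [|[|i]] _ //=; exact: countable0.
move=> s sI nZ.
have wide k : rho k (J s) = J s ->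
    exists s1 s2, [/\ s1 < s, s < s2, fixed k s1 & fixed k s2].
  move=> ks; have fs : fixed k s by [].
  have [s1 [l1 f1]] : exists s1, s1 < s /\ fixed k s1.
    apply: contrapT => no; apply: nZ; left; exists k => //; split=> // s' fs'.
    by rewrite leNgt; apply/negP => lt; apply: no; exists s'.
  have [s2 [l2 f2]] : exists s2, s < s2 /\ fixed k s2.
    apply: contrapT => no; apply: nZ; right; exists k => //; split=> // s' fs'.
    by rewrite leNgt; apply/negP => lt; apply: no; exists s'.
  by exists s1, s2.
have between k s1 s2 t : fixed k s1 -> fixed k s2 -> s1 <= t <= s2 ->
    rho k (J t) = J t.
  move=> [/andP[a1 b1] f1] [/andP[a2 b2] f2] /andP[h1 h2].
  apply: (fix_segment hT f1 f2); rewrite /segment /= /J.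
  by rewrite !geo_dist ?(distrC s1) ?(distrC t s2) ?(distrC s1 s2);
    rewrite ?ger0_norm; lra.
move=> k k' ks k's.
have [s1 [s2 [l1 l2 f1 f2]]] := wide k ks.
have [s1' [s2' [l1' l2' f1' f2']]] := wide k' k's.
pose t1 := Num.max s1 s1'; pose t2 := Num.min s2 s2'.
have [t1s st2] : t1 < s /\ s < t2 by rewrite /t1 /t2 gt_max lt_min l1 l1' l2 l2'.
have [h1 h1'] : s1 <= t1 /\ s1' <= t1 by rewrite /t1 !le_max !lexx orbT.
have [h2 h2'] : t2 <= s2 /\ t2 <= s2' by rewrite /t2 !ge_min !lexx orbT.
have [/andP[a1 b1] _] := f1; have [/andP[a1' b1'] _] := f1'.
have [/andP[a2 b2] _] := f2; have [/andP[a2' b2'] _] := f2'.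
have ne : J t1 <> J t2.
  move=> e; have : mdist (J t1) (J t2) = 0 by rewrite e mdistxx.
  rewrite /J geo_dist; [|lra|lra].
  by move/eqP; rewrite normr_eq0 subr_eq0 => /eqP; lra.
have [c [c1 c2 cP]] := hcyc ne.
have I1 : 0 < t1 < mdist o y by lra.
have I2 : 0 < t2 < mdist o y by lra.
exists c; split.
- by apply: (between c t1 t2); rewrite /fixed//; lra.
- by apply: cP; apply: (between k s1 s2); rewrite //; lra.
- by apply: cP; apply: (between k' s1' s2'); rewrite //; lra.
Qed.

(** A vertex farther than [s] from the point does not lie on the part of [w]
    from the identity to [e], so [e] and the identity are in the same branch. *)
Lemma branch_crossing y w s e x u : crossing y w s e x ->
  s < mdist (rho u o) (geo hT o y s) -> branch u e = first_letter ha u^-1%g.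
Proof.
case=> _ _ _ [j [ej near]] _ far.
have notin j' : (j' <= j)%N -> u <> wv (take j' w).
  by move=> j'j uE; have := near _ j'j; rewrite -uE leNgt far.
rewrite (branch_edge_end ha ej); last exact: notin.
rewrite -[in LHS](mul1g (wv _)) -(first_letter_path ha) ?mulg1// => j' j'j.
rewrite mul1g; move: j'j; rewrite size_take_min leq_min => /andP[j'j _].
by rewrite take_takel//; exact: notin.
Qed.

(** This and the next lemma say that folding identifies the two points over
    [s] exactly at time [s]: the path between the two edges runs through the
    identity, whose image is at distance [s]. *)
Lemma crossing_linked y w w' s s' e e' x x' :
  crossing y w s e x -> crossing y w' s e' x' -> s < s' ->
  linked (geo hT o y s) s' e e'.
Proof.
move=> cr cr' ss' u; rewrite ltNge => ne; apply/negP => far; apply: ne.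
have far' := lt_le_trans ss' far.
by rewrite (branch_crossing cr far') (branch_crossing cr' far').
Qed.

Lemma crossing_not_linked y w w' s e e' x x' : 0 < s < mdist o y ->
  crossing y w s e x -> crossing y w' s e' x' -> ohead w <> ohead w' ->
  ~ linked (geo hT o y s) s e e'.
Proof.
move=> /andP[s0 sC] [_ _ b _ _] [_ _ b' _ _] ne l.
have : branch 1%g e <> branch 1%g e' by rewrite b b'.
by move=> /l; rewrite act1 geo_distl ?ltxx// !ltW.
Qed.

(** Each point [s] of the arc from [o] to [y] is crossed by an edge of either
    path, which gives two points of the rose; view [s] as an edge of a graph
    between these.  A good edge joins two points that the smaller edges do not
    connect in the Cayley tree modulo the group, so the good edges form a forest
    and there are at most as many of them as vertices.  A bad edge connects a
    point with a translate of itself by the stabilizer of its image; this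
    stabilizer being cyclic, this happens at most once for each point of the
    rose, so that bad edges are also at most as numerous as vertices. *)
Lemma folding_bound w w' y : reduced w -> reduced w' -> ohead w <> ohead w' ->
  segment o (rho (wv w) o) y -> segment o (rho (wv w') o) y ->
  (forall j, segment o (rho (wv (take j w)) o) y \/
     mdist (rho (wv (take j w)) o) y <= mdist o y) ->
  (forall j, segment o (rho (wv (take j w')) o) y \/
     mdist (rho (wv (take j w')) o) y <= mdist o y) ->
  mdist o y <= 4 * \sum_i edge_length i.
Proof.
move=> rw rw' ne wy w'y low low'.
have ell0 i : 0 <= edge_length i by exact: mdist_ge0.
have [C0|C0] := leP (mdist o y) 0.
  by apply: le_trans C0 _; rewrite mulr_ge0// sumr_ge0.
set C := mdist o y in C0 *.
(* Outside (0, C) the crossing at the middle of the arc is a default value. *)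
have cr1 s : exists ex : (F * 'I_N) * R, 0 < s < C -> crossing y w s ex.1 ex.2.
  case: (pselect (0 < s < C)) => [/(crossing_exists rw wy low)[e [x h]]|no].
    by exists (e, x).
  have [|e [x _]] := crossing_exists (s := C / 2) rw wy low; first by rewrite -/C; lra.
  by exists (e, x).
have cr2 s : exists ex : (F * 'I_N) * R, 0 < s < C -> crossing y w' s ex.1 ex.2.
  case: (pselect (0 < s < C)) => [/(crossing_exists rw' w'y low')[e [x h]]|no].
    by exists (e, x).
  have [|e [x _]] := crossing_exists (s := C / 2) rw' w'y low'; first by rewrite -/C; lra.
  by exists (e, x).
have [f1 {}cr1] := choice cr1; have [f2 {}cr2] := choice cr2.
pose J := geo hT o y.
pose b1 s := (f1 s).1; pose b2 s := (f2 s).1.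
pose v1 s : 'I_N * R := ((b1 s).2, (f1 s).2).
pose v2 s : 'I_N * R := ((b2 s).2, (f2 s).2).
have [Z cZ gen] := generic_stabilizers y.
have J1 s : 0 < s < C -> edge_point (b1 s) (f1 s).2 = J s by case/cr1.
have J2 s : 0 < s < C -> edge_point (b2 s) (f2 s).2 = J s by case/cr2.
have unlinked s : 0 < s < C -> ~ linked (J s) s (b1 s) (b2 s).
  by move=> sC; apply: (crossing_not_linked _ (cr1 _ sC) (cr2 _ sC)).
have later s s' : 0 < s < C -> s < s' -> linked (J s) s' (b1 s) (b2 s).
  by move=> sC; exact: (crossing_linked (cr1 _ sC) (cr2 _ sC)).
(* [chi s] is the indicator of the vertices identified with [b1 s] before time
   [s]; it is constant along smaller edges, and separates the ends of [s] when
   [s] is good. *)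
pose bad s := exists k, rho k (J s) = J s /\ linked (J s) s (b1 s) (shift k (b2 s)).
pose chi s (v : 'I_N * R) := exists g, edge_point (g, v.1) v.2 = J s /\
  linked (J s) s (b1 s) (g, v.1).
have chi_link s s' e e' x x' : edge_point e x = J s' -> edge_point e' x' = J s' ->
    linked (J s') s e e' -> chi s (e.2, x) -> chi s (e'.2, x').
  move=> ex ex' l [g [/= gx gl]].
  pose h := (g * e.1^-1)%g.
  have hE : shift h e = (g, e.2) by rewrite /shift /h mulgVK.
  have hJ : rho h (J s') = J s by rewrite -ex -edge_point_shift hE.
  exists (shift h e').1; split=> /=.
    by rewrite -[(_, _)]/(shift h e') edge_point_shift ex'.
  apply: linked_trans gl _; rewrite -hE -[(_, e'.2)]/(shift h e') -hJ.
  exact: linked_shift.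
have chi_lt s s' : 0 < s' < C -> s' < s -> chi s (v1 s') <-> chi s (v2 s').
  move=> s'C lt; have l := later _ _ s'C lt.
  split; first exact: chi_link (J1 _ s'C) (J2 _ s'C) l.
  exact: chi_link (J2 _ s'C) (J1 _ s'C) (linked_sym l).
have chi1 s : 0 < s < C -> chi s (v1 s).
  move=> sC; exists (b1 s).1; rewrite -[((b1 s).1, _)]surjective_pairing.
  by split; [exact: J1|exact: linked_refl].
have chi2 s : 0 < s < C -> ~ bad s -> ~ chi s (v2 s).
  move=> sC nb [g /= [gx gl]]; apply: nb; pose h := (g * (b2 s).1^-1)%g.
  have hE : shift h (b2 s) = (g, (b2 s).2) by rewrite /shift /h mulgVK.
  exists h; split; last by rewrite hE.
  by rewrite -[in LHS](J2 _ sC) -edge_point_shift hE.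
(* At the bad time [s] the point [v1 s] is identified with its translate by an
   element [k]; at a later bad time [s'] with the same point, closure under
   roots identifies it, already before [s'], with its translate by the element
   [k'] that makes [s'] bad, and hence with the other end of [s']. *)
have bad_inj s s' : 0 < s < C -> 0 < s' < C -> ~ Z s' -> bad s -> bad s' ->
    s < s' -> v1 s <> v1 s'.
  move=> sC s'C gs' [k [kJ kl]] [k' [k'J k'l]] lt [ei ex].
  pose h := ((b1 s').1 * (b1 s).1^-1)%g.
  have hE : shift h (b1 s) = b1 s'.
    by rewrite /shift /h mulgVK ei -surjective_pairing.
  have hJ : rho h (J s) = J s' by rewrite -(J1 _ sC) -edge_point_shift hE ex J1.
  have kself : linked (J s) s' (b1 s) (shift k (b1 s)).
    have kl' : linked (J s) s' (b1 s) (shift k (b2 s)).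
      by move=> u /kl us; exact: lt_trans us lt.
    apply: linked_trans kl' _; apply: linked_fix => //.
    by apply: linked_sym; exact: later.
  have k1 : k <> 1%g.
    by move=> k1; apply: (unlinked _ sC); move: kl; rewrite k1 shift1.
  pose k2 := (h * k * h^-1)%g.
  have k2self : linked (J s') s' (b1 s') (shift k2 (b1 s')).
    by rewrite -hE -shiftM /k2 mulgVK shiftM -hJ; exact: linked_shift.
  have k2J : rho k2 (J s') = J s' by rewrite -hJ -actM /k2 mulgVK actM kJ.
  have k21 : k2 <> 1%g.
    move=> e; apply: k1; apply: (mulgI h); apply: (mulIg h^-1%g).
    by rewrite mulg1 mulgV.
  have [c [cJ ck2 ck']] := gen _ s'C gs' _ _ k2J k'J.
  have self := linked_cyclic cJ ck2 ck' k21 k2self.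
  apply: (unlinked _ s'C).
  have := linked_trans (linked_sym self) k'l.
  move=> /(linked_fix (fix_invg k'J)); rewrite -!shiftM mulVg !shift1.
  by [].
have in_al s v : 0 < s < C -> ~ Z s -> v = v1 s \/ v = v2 s ->
     0 <= v.2 <= edge_length v.1 /\
     exists2 alpha, alpha \in coordinate_shifts y w ++ coordinate_shifts y w' &
       v.2 = s + alpha \/ v.2 = - s + alpha.
  move=> sC _ [->|->].
    have [_ ? _ _ [al ? ?]] := cr1 _ sC; split=> //.
    by exists al => //; rewrite mem_cat; apply/orP; left.
  have [_ ? _ _ [al ? ?]] := cr2 _ sC; split=> //.
  by exists al => //; rewrite mem_cat; apply/orP; right.
apply: (interval_graph_bound (ltW C0) ell0 cZ in_al) => E V sE hE.
pose badb s := `[< bad s >].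
rewrite -(count_predC badb) -!size_filter mul2n -addnn leq_add//.
  rewrite -(size_map v1); apply: uniq_leq_size; last first.
    by move=> _ /mapP[s + ->]; rewrite mem_filter => /andP[_ /hE[]].
  rewrite map_inj_in_uniq ?filter_uniq ?lt_sorted_uniq// => s s'.
  rewrite !mem_filter => /andP[/asboolP bs /hE [sC Zs _ _]].
  move=> /andP[/asboolP bs' /hE [s'C Zs' _ _]] e.
  case: (ltgtP s s') => // lt; first by case: (bad_inj s s').
  by case: (bad_inj s' s).
set G := seq.filter _ _.
have sG : sorted <%R G by apply: sorted_filter => //; exact: lt_trans.
have GP (i : 'I_(size G)) : [/\ 0 < nth 0 G i < C, ~ bad (nth 0 G i),
    v1 (nth 0 G i) \in V & v2 (nth 0 G i) \in V].
  have : nth 0 G i \in G by exact: mem_nth.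
  by rewrite mem_filter => /andP[/asboolP nb /hE [? _ ? ?]].
apply: (triangular_count (v1 := fun i : 'I_(size G) => v1 (nth 0 G i))
  (v2 := fun i => v2 (nth 0 G i)) (chi := fun i v => `[< chi (nth 0 G i) v >])).
- by move=> k; case: (GP k).
- by move=> k; case: (GP k).
- move=> k; case: (GP k) => sC nb _ _.
  by rewrite (asboolT (chi1 _ sC)) (asboolF (chi2 _ sC nb)).
- move=> k j jk; case: (GP j) => sC _ _ _.
  apply: asbool_equiv_eq; apply: chi_lt => //.
  by rewrite (lt_sorted_ltn_nth 0 sG) ?inE//.
Qed.

(** Translate to the identity the vertex of the path farthest from the arc
    between the images of its ends, and let [y] be the point of the arc nearest
    to its image.  A vertex whose image is separated from [o] by [y] raises no
    objection to [folding_bound]; any other one has [y] as its nearest point on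
    the arc, hence is within [d(o, y)] of it by the choice of the farthest
    vertex. *)
Lemma bounded_backtracking w w' : reduced (w ++ w') ->
  mdist o (rho (wv w) o) + mdist o (rho (wv w') o) <=
  mdist o (rho (wv (w ++ w')) o) + 8 * \sum_i edge_length i.
Proof.
set W := w ++ w' => rW.
have S0 : 0 <= \sum_i edge_length i by apply: sumr_ge0 => i _; exact: mdist_ge0.
pose q j := rho (wv (take j W)) o.
pose end_ := rho (wv W) o.
(* [exc j] is twice the distance of [q j] to the arc from [o] to [end_], plus
   the length of this arc. *)
pose exc j := mdist o (q j) + mdist (q j) end_.
have [m msz mmax] : exists2 m, (m <= size W)%N & forall j, exc j <= exc m.
  pose m := [arg max_(i > (ord0 : 'I_(size W).+1)) exc i]%O.
  exists m; first by have := ltn_ord m.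
  move=> j.
  have [jn|jn] := leqP j (size W).
    have jn' : (j < (size W).+1)%N by [].
    rewrite /m; case: arg_maxP => // i _ /(_ (Ordinal jn') isT).
    by [].
  have -> : exc j = exc (size W).
    by rewrite /exc /q (take_oversize (ltnW jn)) take_size.
  rewrite /m; case: arg_maxP => // i _ /(_ ord_max isT).
  by [].
have [c [c1 c2 c3]] := median_exists hT o end_ (q m).
have excw : mdist o (rho (wv w) o) + mdist o (rho (wv w') o) = exc (size w).
  rewrite /exc /q /W take_size_cat// /end_ /W word_val_cat actM.
  by rewrite act_isom.
suff h : mdist (q m) c <= 4 * \sum_i edge_length i.
  rewrite excw; apply: le_trans (mmax _) _; rewrite /exc -/end_.
  move: c1 c2 c3 h; rewrite /segment /= (metric_sym c (q m)) (metric_sym end_ (q m)).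
  by rewrite (metric_sym end_ c); lra.
pose g := (wv (take m W))^-1%g.
have gq j : rho g (q j) = rho (g * wv (take j W))%g o by rewrite actM.
have gqm : rho g (q m) = o by rewrite gq mulVg act1.
have gend : rho g end_ = rho (wv (drop m W)) o.
  by rewrite /end_ -actM -{1}(cat_take_drop m W) word_val_cat /g mulKg.
pose w1 := rev (map letter_inv (take m W)); pose w2 := drop m W.
have w1E : wv w1 = g by rewrite /w1 word_val_inv.
have low j : segment o (rho g (q j)) (rho g c) \/
    mdist (rho g (q j)) (rho g c) <= mdist o (rho g c).
  rewrite -{1 2}gqm !act_isom.
  case: (pselect (segment (q m) (q j) c)) => [h|no].
    by left; exact/act_segment.
  right.
  case: (segment_split hT (q j) (segment_sym c2)) => // h1.
  case: (segment_split hT (q j) (segment_sym c3)) => // h2.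
  have := mmax j; move: c1 c2 c3 h1 h2; rewrite /exc /segment /=.
  rewrite (metric_sym c (q m)) (metric_sym end_ (q m)) (metric_sym end_ c).
  by rewrite (metric_sym c o) (metric_sym (q j) o); lra.
rewrite -(act_isom rho g) gqm.
case: (posnP (size W)) => [/size0nil W0|Wpos].
  have : c = o.
    have e0 : end_ = o by rewrite /end_ W0 word_val_nil act1.
    apply: mdist_positivity; move: c1.
    rewrite e0 /segment /= mdistxx (metric_sym c o).
    by have := mdist_ge0 o c; lra.
  move=> ->; rewrite /g W0 word_val_nil invg1 act1 mdistxx.
  by rewrite mulr_ge0.
apply: (@folding_bound w1 w2).
- by rewrite reduced_inv reduced_take.
- exact: reduced_drop.
- rewrite /w1 /w2; move: rW Wpos; rewrite -{1 2}(cat_take_drop m W).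
  case: (take m W) / lastP => [|p z]; first by case: (drop m W).
  rewrite map_rcons rev_rcons; case: (drop m W) => [|z' r] //=.
  rewrite /reduced -cats1 -catA /= => red _ [e].
  have := reduced_drop (w := p ++ z :: z' :: r) (size p) red.
  by rewrite drop_size_cat// /reduced /= -e eqxx.
- by rewrite w1E -{1}gqm; apply/act_segment; exact: segment_sym.
- by rewrite /w2 -gend -{1}gqm; apply/act_segment; exact: segment_sym.
- move=> j; have := low (m - j)%N.
  have -> : rho g (q (m - j)%N) = rho (wv (take j w1)) o => //.
  rewrite gq /w1 take_rev size_map size_takel// -map_drop word_val_inv /g.
  rewrite -{1}(cat_take_drop (m - j) (take m W)) word_val_cat invgM.
  by rewrite take_takel ?leq_subr// mulgVK.
- move=> j; have := low (m + j)%N.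
  have -> : rho g (q (m + j)%N) = rho (wv (take j w2)) o => //.
  by rewrite gq takeD word_val_cat /g mulKg.
Qed.
End Folding.

(** * The tree of a system of partial isometries *)

Section SystemTree.
Local Open Scope quotient_scope.
Context {R : realType} {T : metricType R} {N : nat} {F : groupType}.
Variables (rho : isom_action F T) (a : 'I_N -> F) (K : set T).
Implicit Types (g h u : F) (x y : K) (l : R).

Local Notation wv := (word_val a).
Local Notation tree := (system_tree rho a K).
Local Notation cls := (@system_class R N F T rho a K).
Implicit Types X Y : tree.

Lemma system_elt (p : T) : K p -> exists x, val x = p.
Proof. by move=> Kp; exists (exist _ p (mem_set Kp)). Qed.

Lemma system_classE X : exists u x, X = cls u x.
Proof.
exists (repr (X : {eq_quot gluedb_equiv rho a K})).1.
exists (repr (X : {eq_quot gluedb_equiv rho a K})).2.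
by rewrite /system_class -surjective_pairing reprK.
Qed.

Definition reach X Y l : Prop := exists2 c, chain X c Y & chain_length (K := K) c = l.

Lemma reach_refl X : reach X X 0.
Proof. by exists [::]; rewrite // /chain_length big_nil. Qed.

Lemma reach_trans X Y Z l l' : reach X Y l -> reach Y Z l' -> reach X Z (l + l').
Proof.
move=> [c cXY <-] [c' c'YZ <-]; exists (c ++ c'); last first.
  by rewrite /chain_length big_cat.
elim: c X cXY => [|[u [x y]] c IH] X /=; first by move=> ->.
by move=> [-> /IH].
Qed.

Lemma reach_copy u x y : reach (cls u x) (cls u y) (mdist (val x) (val y)).
Proof. by exists [:: (u, (x, y))]; rewrite // /chain_length big_seq1. Qed.

Lemma reach_act h X Y l : reach X Y l -> reach (system_act h X) (system_act h Y) l.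
Proof.
move=> [c cXY <-]; exists [seq ((h * e.1)%g, e.2) | e <- c]; last first.
  by rewrite /chain_length big_map.
elim: c X cXY => [|[u [x y]] c IH] X /=; first by move=> ->.
by move=> [-> /IH]; rewrite !system_actE.
Qed.

Lemma glue_letter u z x y : val x = rho (letter_val a z) (val y) ->
  cls u x = cls (u * letter_val a z)%g y.
Proof.
move=> xy; apply/system_classP; exists [:: z]; split=> //=.
  by rewrite word_val_cons word_val_nil mulg1 mulKg.
exists (val y); last by split=> //; exact: set_valP.
split; last by rewrite xy actVK.
split; first exact: set_valP.
by exists (val y) => //; exact: set_valP.
Qed.

Lemma reach_ge0 X Y l : reach X Y l -> 0 <= l.
Proof. by move=> [c _ <-]; apply: sumr_ge0 => e _; exact: mdist_ge0. Qed.

Lemma word_rel_val w p q : word_rel rho a K w p q -> rho (wv w) q = p.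
Proof.
elim: w p => [|z w IH] p /=; first by move=> [_ ->]; rewrite word_val_nil act1.
by move=> [p' [_ ->] /IH]; rewrite word_val_cons actM => ->; rewrite actKV.
Qed.

(** The map to [T] induced by [(u, x) |-> u x], which is equivariant and isometric
    on each copy of [K]. *)
Definition develop X : T :=
  let p := repr (X : {eq_quot gluedb_equiv rho a K}) in rho p.1 (val p.2).

Lemma develop_class u x : develop (cls u x) = rho u (val x).
Proof.
rewrite /develop; case E: (repr _) => [v y] /=.
have : glued rho a (v, y) (u, x).
  by apply/system_classP; rewrite {1}/system_class -E reprK.
move=> [w [_ /= wE /word_rel_val <-]].
by rewrite wE -actM mulVKg.
Qed.

Lemma develop_act h X : develop (system_act h X) = rho h (develop X).
Proof.
have [u [x ->]] := system_classE X.
by rewrite system_actE !develop_class actM.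
Qed.

Lemma develop_le X Y l : reach X Y l -> mdist (develop X) (develop Y) <= l.
Proof.
move=> [c cXY <-]; elim: c X cXY => [|[u [x y]] c IH] X /=.
  by move=> ->; rewrite mdistxx /chain_length big_nil.
move=> [-> /IH le]; rewrite /chain_length big_cons /=.
apply: le_trans (metric_triangle _ (develop (cls u y)) _) _.
by rewrite !develop_class act_isom -develop_class lerD2l.
Qed.

Hypothesis meets : forall i, K `&` translate rho K (a i) !=set0.
Hypothesis ha : free_basis a.

Lemma meets_letter z : exists x y, val x = rho (letter_val a z) (val y).
Proof.
case: z => i b; have [p [Kp [q Kq qp]]] := meets i.
have [x xE] := system_elt Kp; have [y yE] := system_elt Kq.
case: b; rewrite /letter_val /=; last by exists x, y; rewrite xE yE.
by exists y, x; rewrite xE yE -qp actVK.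
Qed.

Lemma reach_exists X Y : exists l, reach X Y l.
Proof.
have [u [x ->]] := system_classE X; have [v [y ->]] := system_classE Y.
rewrite -(mulVKg u v) -(word_ofK ha (u^-1 * v)%g).
move: (word_of ha (u^-1 * v)%g) => w; elim: w u x => [|z w IH] u x.
  by rewrite word_val_nil mulg1; exists (mdist (val x) (val y)); exact: reach_copy.
have [p [q pq]] := meets_letter z.
have [l hl] := IH (u * letter_val a z)%g q.
rewrite word_val_cons mulgA; exists (mdist (val x) (val p) + l).
apply: reach_trans hl.
rewrite -(glue_letter u pq); exact: reach_copy.
Qed.

Lemma system_dist_ge0 X Y : 0 <= system_dist X Y.
Proof.
have [l [c cXY cl]] := reach_exists X Y.
apply: lb_le_inf; first by exists l, c.
move=> _ [c' c'XY <-]; apply: (@reach_ge0 X Y); by exists c'.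
Qed.

Lemma system_dist_le X Y l : reach X Y l -> system_dist X Y <= l.
Proof.
move=> [c cXY <-]; apply: ge_inf; last by exists c.
by exists 0 => _ [c' c'XY <-]; apply: (@reach_ge0 X Y); exists c'.
Qed.

Lemma translation_length_le_system (w : F) : K !=set0 ->
  translation_length (@mdist R T) (rho w) <=
  translation_length (@system_dist R N F T rho a K) (system_act w).
Proof.
move=> [p /system_elt[x _]]; apply: lb_le_inf.
  by exists (system_dist (cls 1%g x) (system_act w (cls 1%g x))), (cls 1%g x).
move=> _ [X _ <-]; have [l [c cX cl]] := reach_exists X (system_act w X).
apply: lb_le_inf; first by exists l, c.
move=> _ [c' c'X <-].
have /develop_le : reach X (system_act w X) (chain_length c') by exists c'.
rewrite develop_act; apply: le_trans; apply: ge_inf; last by exists (develop X).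
by exists 0 => _ [p' _ <-]; exact: mdist_ge0.
Qed.

Lemma translation_length_system_le (w : F) X l : reach X (system_act w X) l ->
  translation_length (@system_dist R N F T rho a K) (system_act w) <= l.
Proof.
move=> h; apply: le_trans (system_dist_le h); apply: ge_inf; last by exists X.
by exists 0 => _ [X' _ <-]; exact: system_dist_ge0.
Qed.

End SystemTree.

(** * Lifting arcs to the tree of a system *)

Section ShortChains.
Context {R : realType} {T : metricType R} {N : nat} {F : groupType}.
Hypothesis hT : real_tree T.
Variable rho : isom_action F T.
Variable a : 'I_N -> F.
Variables (o : T) (B L : R).
Implicit Types (g h u : F) (w : seq (letter N)) (p q y : T) (K : set T).

Local Notation wv := (word_val a).

Hypothesis back : forall w w', reduced (w ++ w') ->
  mdist o (rho (wv w) o) + mdist o (rho (wv w') o) <=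
  mdist o (rho (wv (w ++ w')) o) + B.
Hypothesis L0 : 0 <= L.
Hypothesis gens : forall i, mdist o (rho (a i) o) <= L.

Lemma backtracking_ge0 : 0 <= B.
Proof.
have := back (isT : reduced ([::] ++ [::])).
by rewrite /= word_val_nil act1 mdistxx !add0r.
Qed.

(** Backtracking between two vertices of a path, by translating a subword. *)
Lemma back_sub w i j : reduced w -> (i <= j)%N ->
  mdist (rho (wv (take i w)) o) (rho (wv (take j w)) o) +
  mdist (rho (wv (take j w)) o) (rho (wv w) o) <=
  mdist (rho (wv (take i w)) o) (rho (wv w) o) + B.
Proof.
move=> rw ij.
pose u := drop i (take j w); pose v := drop j w.
have tj : take j w = take i w ++ u.
  by rewrite -{1}(cat_take_drop i (take j w)) take_takel.
have uv : u ++ v = drop i w.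
  have e : w = take i w ++ (u ++ v) by rewrite catA -tj cat_take_drop.
  have [il|il] := leqP i (size w).
    by rewrite [in RHS]e drop_size_cat// size_takel.
  rewrite /u /v !drop_oversize// ?size_take_min; lia.
have wE : w = take i w ++ (u ++ v) by rewrite catA -tj cat_take_drop.
have ww : wv w = (wv (take i w) * wv (u ++ v))%g by rewrite {1}wE word_val_cat.
rewrite ww tj !word_val_cat !actM -(actM rho (wv u) (wv v)) -word_val_cat !act_isom.
rewrite word_val_cat actM act_isom -actM -word_val_cat.
by apply: back; rewrite uv; exact: reduced_drop.
Qed.

Lemma letter_step z : mdist o (rho (letter_val a z) o) <= L.
Proof.
case: z => i [] /=; rewrite /letter_val /=; last exact: gens.
by rewrite metric_sym act_distl gens.
Qed.

Definition chain_radius : R := 5 / 2 * B + 8 + L.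

Section Path.
Variables (w : seq (letter N)) (y : T).
Hypothesis rw : reduced w.
Hypothesis oy : mdist o y <= 1.

Let q i := rho (wv (take i w)) o.
Let y' := rho (wv w) y.
Let D := mdist y y'.
Let J := geo hT y y'.

(** The projections of the vertices [q i] to the arc from [y] to [y'], moved
    to the origin for [i = 0], and their running maxima. *)
Let tau i : R := if i is 0%N then 0 else proj_param y y' (q i).
Fixpoint running_max i : R :=
  if i is i'.+1 then Num.max (running_max i') (tau i) else 0.
Let mu := running_max.

Lemma tau_itv i : 0 <= tau i <= D.
Proof. by case: i => [|i] /=; [rewrite lexx mdist_ge0|exact: proj_param_itv]. Qed.

Lemma mu_itv i : 0 <= mu i <= D.
Proof.
elim: i => [|i IH] /=; first by rewrite lexx mdist_ge0.
have := tau_itv i.+1; rewrite le_max ge_max => /andP[h1 h2].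
by case/andP: IH => -> ->; rewrite h2.
Qed.

Lemma mu_ge i : tau i <= mu i.
Proof. by case: i => [|i] //=; rewrite le_max lexx orbT. Qed.

Lemma mu_attained i : exists2 j, (j <= i)%N & mu i = tau j.
Proof.
elim: i => [|i [j ji e]]; first by exists 0%N.
rewrite /mu /=; case: (leP (running_max i) (tau i.+1)) => h.
  by exists i.+1.
by exists j => //; exact: leqW.
Qed.

Lemma end_close : mdist (rho (wv w) o) y' <= 1.
Proof. by rewrite /y' act_isom. Qed.

Lemma projection_close i : mdist (q i) (J (tau i)) <= B / 2 + 2.
Proof.
have B0 := backtracking_ge0.
case: i => [|i].
  rewrite /= /J geo0 /q take0 word_val_nil act1. by move: oy; lra.
have := proj_param_dist hT y y' (q i.+1) => /=.
have := back_sub rw (leq0n i.+1); rewrite take0 word_val_nil act1 -/(q _).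
have t1 := metric_triangle y o (q i.+1).
have t2 := metric_triangle y' (rho (wv w) o) (q i.+1).
have t3 := metric_triangle o y (rho (wv w) o).
have t4 := metric_triangle y y' (rho (wv w) o).
have := end_close; rewrite -/D in t4 *.
move: t1 t2 t3 t4 oy; rewrite (metric_sym y' (rho _ o)) (metric_sym y o).
by rewrite (metric_sym (rho _ o) (q _)); rewrite /J -/D /=; lra.
Qed.

(** Running maxima stay close to the path: if the path has gone back from its
    farthest projection, it has done so by a bounded amount. *)
Lemma running_max_close i : mdist (q i) (J (mu i)) <= 5 / 2 * B + 8.
Proof.
have B0 := backtracking_ge0.
have [j ji e] := mu_attained i.
have bb := back_sub rw ji; rewrite -!/(q _) in bb.
have pj := projection_close j; have pi := projection_close i.
have ej := geo_distr hT (tau_itv j); have ei := geo_distr hT (tau_itv i).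
have ec := end_close; have ge := mu_ge i.
rewrite -!/J -/D in ej ei.
have t1 := metric_triangle (q i) (q j) (J (tau j)).
have t2 := metric_triangle (q j) (J (tau j)) (rho (wv w) o).
have t3 := metric_triangle (J (tau j)) y' (rho (wv w) o).
have t4 := metric_triangle (J (tau i)) (q i) y'.
have t5 := metric_triangle (q i) (rho (wv w) o) y'.
rewrite (metric_sym y') in t3; rewrite (metric_sym (J (tau i)) (q i)) in t4.
rewrite (metric_sym (q i) (q j)) in t1.
by rewrite e in ge *; lra.
Qed.

Lemma next_vertex_close i : (i < size w)%N ->
  mdist (q i.+1) (J (mu i)) <= chain_radius.
Proof.
move=> iw; have h := running_max_close i.
have [z0 _] : exists z : letter N, True by case: w iw => // z *; exists z.
have : mdist (q i.+1) (q i) <= L.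
  rewrite /q (word_val_take_nth a z0 iw) actM act_isom metric_sym.
  exact: letter_step.
have := metric_triangle (q i.+1) (q i) (J (mu i)).
by rewrite /chain_radius; lra.
Qed.

(** The [i]-th position on the arc, seen from the [i]-th copy of [K] and from the
    next one, in which the chain passes from one to the other. *)
Let stops : seq T :=
  y :: [seq rho (wv (take i w))^-1%g (J (mu i)) | i <- iota 0 (size w).+1] ++
  [seq rho (wv (take i.+1 w))^-1%g (J (mu i)) | i <- iota 0 (size w)].

(** The chain stays in the [i]-th copy of [K] between the positions [mu (i - 1)]
    and [mu i]; as the positions are nondecreasing, the pieces add up to the
    length of the arc. *)
Lemma short_chain : exists2 S : seq T, (forall p, p \in S -> mdist o p <= chain_radius) &
  forall K, (forall p, p \in S -> K p) -> exists x : K, val x = y /\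
    reach (rho := rho) (a := a) (system_class rho a 1%g x) (system_class rho a (wv w) x) D.
Proof.
have B0 := backtracking_ge0.
exists stops.
  move=> p; rewrite inE => /orP[/eqP ->|].
    by apply: le_trans oy _; move: L0; rewrite /chain_radius; lra.
  rewrite mem_cat => /orP[] /mapP[i]; rewrite mem_iota add0n => /andP[_ iw] ->.
    rewrite metric_sym act_distl metric_sym; apply: le_trans (running_max_close i) _.
    by move: L0; rewrite /chain_radius; lra.
  rewrite metric_sym act_distl metric_sym; exact: next_vertex_close.
move=> K SK.
have Ky : K y by apply: SK; rewrite inE eqxx.
have Kcur i : (i <= size w)%N -> K (rho (wv (take i w))^-1%g (J (mu i))).
  move=> iw; apply: SK; rewrite inE mem_cat; apply/orP; right; apply/orP; left.
  by apply/mapP; exists i; rewrite ?mem_iota// ltnS.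
have Knext i : (i < size w)%N -> K (rho (wv (take i.+1 w))^-1%g (J (mu i))).
  move=> iw; apply: SK; rewrite inE mem_cat; apply/orP; right; apply/orP; right.
  by apply/mapP; exists i; rewrite ?mem_iota.
have [x xE] := system_elt Ky; exists x; split=> //.
have upto i : (i <= size w)%N -> forall z : K,
    val z = rho (wv (take i w))^-1%g (J (mu i)) ->
    reach (system_class rho a 1%g x) (system_class rho a (wv (take i w)) z) (mu i).
  elim: i => [|i IH] iw z zE.
    rewrite /mu /= take0 word_val_nil.
    suff -> : z = x by exact: reach_refl.
    by apply: val_inj; rewrite zE xE take0 word_val_nil invg1 act1 /mu /= /J geo0.
  have [z1 z1E] := system_elt (Kcur i (ltnW iw)).
  have [z2 z2E] := system_elt (Knext i iw).
  have [z0 _] : exists z : letter N, True by case: w iw => // l *; exists l.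
  have step := IH (ltnW iw) z1 z1E.
  have glue : system_class rho a (wv (take i w)) z1 = system_class rho a (wv (take i.+1 w)) z2.
    rewrite (word_val_take_nth a z0 iw); apply: glue_letter.
    by rewrite z1E z2E (word_val_take_nth a z0 iw) invgM actM actKV.
  rewrite glue in step.
  have := reach_trans step (reach_copy rho a (wv (take i.+1 w)) z2 z).
  have -> // : mu i + mdist (val z2) (val z) = mu i.+1.
  rewrite z2E zE act_isom /J geo_dist ?mu_itv// distrC ger0_norm; first by rewrite addrC subrK.
  by rewrite subr_ge0 /mu /= le_max lexx.
have [z zE] := system_elt (Kcur _ (leqnn _)).
have := reach_trans (upto _ (leqnn _) z zE) (reach_copy rho a (wv (take (size w) w)) z x).
rewrite take_size in zE *.
have -> // : mu (size w) + mdist (val z) (val x) = D.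
rewrite zE xE act_distl -/y' /J geo_distr ?mu_itv//.
by rewrite -/D addrC subrK.
Qed.
End Path.
End ShortChains.

(** * The approximating finite subtrees *)

(** With dense orbits, a point almost realizing the translation length of [g]
    can be moved near [o]; this replaces [g] by a conjugate. *)
Lemma almost_realizing_chain {R : realType} {T : metricType R} {N : nat}
    {F : groupType} (hT : real_tree T) (rho : isom_action F T) (a : 'I_N -> F)
    (ha : free_basis a) (o : T) (B L : R) :
  (forall w w', reduced (w ++ w') ->
    mdist o (rho (word_val a w) o) + mdist o (rho (word_val a w') o) <=
    mdist o (rho (word_val a (w ++ w')) o) + B) ->
  0 <= L -> (forall i, mdist o (rho (a i) o) <= L) ->
  dense_orbits rho -> forall (g : F) (eps : R), 0 < eps ->
  exists2 S : seq T, (forall p, p \in S -> mdist o p <= chain_radius B L) &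
    forall K : set T, (forall p, p \in S -> K p) ->
    exists (X : system_tree rho a K) (l : R), reach X (system_act g X) l /\
      l <= translation_length (@mdist R T) (rho g) + eps.
Proof.
move=> back L0 gens dense g eps eps0.
have [p pl] : exists p, mdist p (rho g p) < translation_length (@mdist R T) (rho g) + eps.
  have [|_ [p _ <-] lt] := @inf_adherent R [set mdist x (rho g x) | x in [set: T]] _ eps0.
    split; first by exists (mdist o (rho g o)), o.
    by exists 0 => _ [p _ <-]; exact: mdist_ge0.
  by exists p.
have [h hp] : exists h, mdist p (rho h o) < 1.
  have [|z [/interior_subset hb [h _ he]]] := dense o (ball p 1)^° _ (open_interior _).
    by exists p; exact: nbhsx_ballx.
  by exists h; move: hb; rewrite -he ballEmdist.
pose y := rho h^-1%g p; pose w := word_of ha (h^-1 * g * h)%g.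
have oy : mdist o y <= 1 by rewrite metric_sym act_distl ltW.
have [S Sb SK] := short_chain hT back L0 gens (word_of_reduced ha (h^-1 * g * h)%g) oy.
exists S => // K /SK [x [xy hx]].
exists (system_class rho a h x), (mdist p (rho g p)); split; last exact: ltW.
have := reach_act h hx; rewrite !system_actE mulg1 word_ofK.
have -> : (h * (h^-1 * g * h) = g * h)%g by rewrite !mulgA mulgV mul1g.
by rewrite -actM -2!mulgA mulgV mulg1 act_distl actM actKV.
Qed.

Set Strict Implicit.
Unset Implicit Arguments.

Theorem corollary6p3 (R : realType) (N : nat) (hN : (2 <= N)%N)
  (F : groupType) (a : 'I_N -> F) (ha : free_basis a)
  (T : metricType R) (hT : real_tree T) (rho : isom_action F T)
  (hvs : very_small rho) (hmin : minimal_action rho)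
  (hdense : dense_orbits rho) :
  exists K : nat -> set T,
    [/\ forall n, finite_subtree (K n),
        exists C : R, forall n x y, K n x -> K n y -> mdist x y <= C,
        forall n i, K n `&` translate rho (K n) (a i) !=set0 &
        forall w : F,
          translation_length (@system_dist R N F T rho a (K n))
            (system_act w) @[n --> \oo]
          --> translation_length (@mdist R T) (rho w)].
Proof.
have [[o _] _ _] := hT.
pose L := \sum_i edge_length rho a o i.
have L0 : 0 <= L by apply: sumr_ge0 => i _; exact: mdist_ge0.
have gens i : mdist o (rho (a i) o) <= L.
  by rewrite /L (bigD1 i)//= lerDl sumr_ge0// => j _; exact: mdist_ge0.
have back := bounded_backtracking hT ha (very_small_cyclic_arcs hT hvs) o.
pose r := chain_radius (8 * L) L.
have chains := almost_realizing_chain hT ha back L0 gens hdense.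
(* The pairs of a word and a precision [m.+1%:R^-1] are enumerated by the
   natural numbers [k]. *)
have data k : exists S : seq T, (forall p, p \in S -> mdist o p <= r) /\
    forall w m, unpickle k = Some (w, m) -> forall K : set T,
    (forall p, p \in S -> K p) ->
    exists (X : system_tree rho a K) (l : R), reach X (system_act (word_val a w) X) l /\
      l <= translation_length (@mdist R T) (rho (word_val a w)) + m.+1%:R^-1.
  case E : (unpickle k) => [[w m]|]; last by exists [::]; split.
  have e0 : 0 < m.+1%:R^-1 :> R by rewrite invr_gt0.
  have [S Sb SK] := chains (word_val a w) _ e0.
  by exists S; split=> // w' m' [<- <-].
have [S SP] := choice data.
(* These points make [K n] meet its translates by the generators. *)
pose base : set T := [set o] `|` [set rho (a i)^-1%g o | i in [set: 'I_N]].
pose pts n : set T := base `|` \bigcup_(k in `I_n) [set` S k].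
pose K n := convex_hull (pts n).
have r0 : L <= r.
  have := backtracking_ge0 back; rewrite /r /chain_radius -/L; lra.
have ptsr n p : pts n p -> mdist o p <= r.
  case=> [[->|[i _ <-]]|[k _ /(proj1 (SP k))]] //.
    by rewrite mdistxx (le_trans L0).
  by rewrite metric_sym act_distl (le_trans (gens i)).
have Kr n p : K n p -> mdist o p <= r.
  by move=> h; apply: (h [set z | mdist o z <= r]); split; [exact: ball_convex|exact: ptsr].
have ptsK n p : pts n p -> K n p by move=> h A [_]; apply.
have Ko n : K n o by apply: ptsK; left; left.
have meets n i : K n `&` translate rho (K n) (a i) !=set0.
  exists o; split; first exact: Ko.
  exists (rho (a i)^-1%g o); last exact: actKV.
  by apply: ptsK; left; right; exists i.
exists K; split=> //.
- move=> n; exists (pts n); split=> //; last by exists o; left; left.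
  rewrite finite_setU; split.
    by rewrite finite_setU; split; [exact: finite_set1|exact/finite_image/finite_finset].
  by apply: bigcup_finite => // k _; exact: finite_seq.
- exists (2 * r) => n x y Kx Ky; apply: le_trans (metric_triangle x o y) _.
  by rewrite (metric_sym x o) mulr2n mulrDl mul1r lerD// (Kr n).
move=> g; rewrite -(word_ofK ha g); set w := word_of ha g.
apply/cvgrPdist_le => eps eps0.
have [m me] : exists m, m.+1%:R^-1 <= eps.
  by have [m] := ltr_add_invr eps0; rewrite add0r => /ltW; exists m.
exists (pickle (w, m)).+1 => // n /= kn.
have [X [l [hr hl]]] : exists (X : system_tree rho a (K n)) (l : R),
    reach X (system_act (word_val a w) X) l /\
      l <= translation_length (@mdist R T) (rho (word_val a w)) + m.+1%:R^-1.
  apply: ((SP (pickle (w, m))).2 w m); first exact: pickleK.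
  by move=> p pS; apply: ptsK; right; exists (pickle (w, m)).
have up := translation_length_system_le (meets n) ha hr.
have lo := @translation_length_le_system _ _ _ _ rho a (K n) (meets n) ha (word_val a w)
  (ex_intro _ o (Ko n)).
rewrite distrC ger0_norm ?subr_ge0// lerBlDl.
by apply: le_trans up (le_trans hl _); rewrite lerD2l.
Qed.
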